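(* Let $q$ be a prime power, $n\ge 2$, and let $C\subsetneq \mathbf{F}_q^{2n}$ be an $\mathbf{F}_q$-linear subspace with $C\supsetneq C\cap C^{\perp s}$ and $2c=\dim C^{\perp s}-\dim (C\cap C^{\perp s})>0$. Let $\emptyset\ne I\subsetneq K\subseteq\{1,\dots,n\}$, where $K$ is a repair group for the set $I$ of erasures, i.e. $\pi_I(C+C^{\perp s})=\pi_I(\sigma_K(C^{\perp s}))$. Let $B_I$, $\widetilde B_V$, $\widetilde V=\langle\widetilde B_V\rangle$, $P$ and $J$ be produced by the reduction procedure described in the context from $C^{\perp s}$, $I$, $K$ with $W=\sigma_{K\setminus I}(C^{\perp s})$, and let $\beta:C^{\perp s}\to (C')^{\perp s}$ be the map described in the context. Then: 1. $J$ (which satisfies $I\subseteq J\subseteq K$) and basis vectors of $\sigma_I(C^{\perp s})\oplus\widetilde V$ are computed by the procedure in $O(|K|^3)$ complexity (operations in $\mathbf{F}_q$), under the assumption that a basis of $\sigma_K(C^{\perp s})$ is precomputed for each repair group $K$. 2. $|J|\le |K|-|P|$. 3. The set $O=\{\beta(\vec u): \vec u \text{ is a row of } B_I \text{ or of } \widetilde B_V\}$ defines a sufficient set of observables for correcting erasures at $I$, and $J$ is the set of qudits measured by the decoder among the $n$ codeword qudits, i.e. $J=\{1,\dots,n\}\cap\bigcup_{\vec v\in O}\operatorname{supp}(\vec v)$. 4. The set of observables $O$ has size $|O|=\dim\pi_I(C^{\perp s})$, and this is the smallest possible size of a set of observables for correcting erasures in $I$ by the entanglement-assisted code $Q(C)$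 (with any repair group).
   Context: Notation. For $\vec x=(a_1,\dots,a_m|b_1,\dots,b_m)$, $\vec y=(c_1,\dots,c_m|d_1,\dots,d_m)$ in $\mathbf{F}_q^{2m}$, $\langle \vec x,\vec y\rangle_s=\sum_{i=1}^m (a_id_i-b_ic_i)$; $S^{\perp s}$ is the orthogonal space of $S$ for this form; $\operatorname{supp}(\vec x)=\{i:(a_i,b_i)\ne(0,0)\}$. For a set $K$ of indices and a subspace $S$, $\pi_K(S)=\{((a_i)_{i\in K}|(b_i)_{i\in K}):(\vec a|\vec b)\in S\}$ (puncturing) and $\sigma_K(S)=\{((a_i)_{i\in K}|(b_i)_{i\in K}):(\vec a|\vec b)\in S,\ (a_i,b_i)=(0,0)\text{ for all } i\notin K\}$ (shortening). In the procedure below, shortened spaces are regarded as subspaces of $\mathbf{F}_q^{2n}$ by padding zeros at the missing coordinates. $\langle B\rangle$ is the row space of a matrix $B$. Dimensions are over $\mathbf{F}_q$. The code $Q(C)$. There is an $\mathbf{F}_q$-linear $C'\subseteq\mathbf{F}_q^{2n+2c}$ (vectors $(a_1,\dots,a_{n+c}|b_1,\dots,b_{n+c})$) with $\dim C'=\dim C+2c$, $\sigma_{\{1,\dots,n\}}(C')=C$, $\pi_{\{1,\dots,n\}}((C')^{\perp s})=C^{\perp s}$, $(C')^{\perp s}\subseteq C'$, and a surjective $\mathbf{F}_p$-linear map $\alpha:C^{\perp s}\to\mathbf{F}_q^{2c}$ ($p$ the characteristic of $\mathbf{F}_q$) such that $(C')^{\perp s}$ is the set of all vectors $(a_1,\dots,a_{n+c}|b_1,\dots,b_{n+c})$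 with $\vec x=(a_1,\dots,a_n|b_1,\dots,b_n)\in C^{\perp s}$ and $(a_{n+1},\dots,a_{n+c}|b_{n+1},\dots,b_{n+c})=\alpha(\vec x)$. Fix such $C'$ and $\alpha$. For $\vec x\in C^{\perp s}$, $\beta(\vec x)$ denotes this vector of $(C')^{\perp s}$; $\beta$ is an $\mathbf{F}_p$-linear isomorphism $C^{\perp s}\to(C')^{\perp s}$. The entanglement-assisted quantum error-correcting code $Q(C)$ consists of the first $n$ qudits (the codeword qudits) of the stabilizer code $Q(C')$ on $n+c$ qudits with stabilizer given by $(C')^{\perp s}$; the last $c$ qudits are held by the decoder without error. Repair groups. $K\supseteq I$ is a repair group for $I$ if erasures at $I$ can be corrected by acting only on codeword qudits in $K$ (and the decoder's preshared qudits); this is equivalent to $\pi_I(C+C^{\perp s})=\pi_I(\sigma_K(C^{\perp s}))$, which is used as the definition. Observables. A set of observables is given by a finite set $T\subseteq (C')^{\perp s}$; measuring it when an error $\vec e\in\mathbf{F}_q^{2(n+c)}$ has occurred yields the syndromes $\langle\vec e,\vec v\rangle_s$, $\vec v\in T$, and measures exactly the qudits in $\bigcup_{\vec v\in T}\operatorname{supp}(\vec v)$. Its size is $|T|$. The set $T$ is sufficient for correcting erasures at $I$ if the syndromes determine every error supported in $I$ up to an element of the stabilizer, i.e. every $\vec e\in\mathbf{F}_q^{2(n+c)}$ with $\operatorname{supp}(\vec e)\subseteq I$ and $\langle\vec e,\vec v\rangle_s=0$ for all $\vec v\in T$ lies in $(C')^{\perp s}$. The reduction procedure. Choose a direct sum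 decomposition $\sigma_K(C^{\perp s})=\sigma_I(C^{\perp s})\oplus\sigma_{K\setminus I}(C^{\perp s})\oplus V$. Let $B_I$, $B_V$, $B_W$ be matrices whose rows form bases of $\sigma_I(C^{\perp s})$, $V$, and $W=\sigma_{K\setminus I}(C^{\perp s})$. Greedy step: start with $P=\emptyset$, $C_{\mathrm{sel}}=\emptyset$, and maintain a matrix $U$ in row echelon form whose rows are a basis of the span of the columns of $B_W$ indexed by $C_{\mathrm{sel}}$. Run through the qudits $\ell\in K\setminus I$ in some order. Let $\vec c_\ell,\vec c_{n+\ell}$ be columns $\ell,n+\ell$ of $B_W$. Reduce $\vec c_\ell$ against the rows of $U$; if the remainder is zero discard $\ell$. Otherwise reduce $\vec c_{n+\ell}$ against the rows of $U$ together with the remainder of $\vec c_\ell$; if this second remainder is nonzero, accept $\ell$ (put $\ell$ into $P$, put $\ell,n+\ell$ into $C_{\mathrm{sel}}$, and update $U$ with the two new echelonized rows), else discard $\ell$. The resulting $P$ satisfies $\dim\pi_P(W)=2|P|$. Elimination step: choose a matrix $M\in\mathbf{F}_q^{\dim V\times\dim W}$ such that $\widetilde B_V=B_V-MB_W$ has zero columns at all indices in $C_{\mathrm{sel}}$. Finally $J=I\cup\bigcup_{\vec u\in\operatorname{rows}(\widetilde B_V)}\operatorname{supp}(\vec u)$. *)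

(* Defs.v *)
From HB Require Import structures.
From mathcomp Require Import all_boot all_algebra.
Set Implicit Arguments.
Unset Strict Implicit.
Unset Printing Implicit Defensive.
Import GRing.Theory.
Local Open Scope ring_scope.

(* A vector (a_1,...,a_m|b_1,...,b_m) of F^{2m} is a row vector of length
   m + m, with a_i at index lshift m i and b_i at index rshift m i. *)
Section Symplectic.
Variable F : finFieldType.

Section OneSpace.
Variable m : nat.
Implicit Types (x y : 'rV[F]_(m + m)) (S : {vspace 'rV[F]_(m + m)}).
Implicit Types (K : {set 'I_m}).

Definition symp x y : F :=
  \sum_(i < m) (x 0 (lshift m i) * y 0 (rshift m i)
                - x 0 (rshift m i) * y 0 (lshift m i)).

Definition supp x : {set 'I_m} :=
  [set i | (x 0 (lshift m i), x 0 (rshift m i)) != (0, 0)].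

(* The spanning sets of symp_orth and supported are already subspaces: see
   mem_symp_orth and mem_supported. *)
Definition symp_orth S : {vspace 'rV[F]_(m + m)} :=
  <<enum [set x | [forall (y | y \in S), symp x y == 0%R]]>>%VS.

Definition supported K : {vspace 'rV[F]_(m + m)} :=
  <<enum [set x | supp x \subset K]>>%VS.

(* sigma_K(S), padded with zeros at the coordinates outside K. *)
Definition shorten0 K S : {vspace 'rV[F]_(m + m)} := (S :&: supported K)%VS.

Lemma mem_span_closed (X : {set 'rV[F]_(m + m)}) x :
    0 \in X -> (forall a y z, y \in X -> z \in X -> a *: y + z \in X) ->
  (x \in <<enum X>>%VS) = (x \in X).
Proof.
move=> X0 XD; apply/idP/idP => [|xX]; last by apply: memv_span; rewrite mem_enum.
move=> /(coord_span (X := in_tuple (enum X))) ->.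
apply: (big_ind (fun v => v \in X)) => // [y z yX zX|i _].
  by rewrite -[y]scale1r XD.
by rewrite -[_ *: _]addr0 XD // -mem_enum mem_nth.
Qed.

Lemma mem_symp_orth S x :
  (x \in symp_orth S) = [forall (y | y \in S), symp x y == 0].
Proof.
rewrite mem_span_closed ?inE // => [|a y z].
  apply/forall_inP => y _; rewrite /symp big1 // => i _.
  by rewrite !mxE !mul0r subr0.
rewrite !inE => /forall_inP Hy /forall_inP Hz; apply/forall_inP => t tS.
suff -> : symp (a *: y + z) t = a * symp y t + symp z t.
  by rewrite (eqP (Hy t tS)) (eqP (Hz t tS)) mulr0 addr0.
rewrite /symp mulr_sumr -big_split; apply: eq_bigr => i _ /=.
by rewrite !mxE !mulrDl -!mulrA opprD mulrBr addrACA.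
Qed.

Lemma mem_supported K x : (x \in supported K) = (supp x \subset K).
Proof.
have suppE y i : (i \in supp y) =
    ((y 0 (lshift m i), y 0 (rshift m i)) != (0, 0)) by rewrite inE.
have out y i : supp y \subset K -> i \notin K ->
    y 0 (lshift m i) = 0 /\ y 0 (rshift m i) = 0.
  move=> /subsetP yK iK; have : i \notin supp y by apply: contra iK => /yK.
  by rewrite suppE negbK => /eqP [-> ->].
rewrite mem_span_closed ?inE // => [|a y z].
  by apply/subsetP => i; rewrite suppE !mxE eqxx.
rewrite !inE => yK zK; apply/subsetP => i; apply: contraLR => iK.
have [y1 y2] := out y i yK iK; have [z1 z2] := out z i zK iK.
by rewrite suppE !mxE y1 y2 z1 z2 !mulr0 !addr0 eqxx.
Qed.

End OneSpace.

Section Reindex.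
Variables (k m : nat) (f : 'I_k -> 'I_m).

Definition pair_index (j : 'I_(k + k)) : 'I_(m + m) :=
  match split j with
  | inl i => lshift m (f i)
  | inr i => rshift m (f i)
  end.

(* Puncturing and shortening to the coordinates f 0, ..., f (k - 1), for f
   injective, as subspaces of F^{2k}. *)
Definition puncture (S : {vspace 'rV[F]_(m + m)}) : {vspace 'rV[F]_(k + k)} :=
  (linfun (colsub pair_index) @: S)%VS.

Definition shortened (S : {vspace 'rV[F]_(m + m)}) : {vspace 'rV[F]_(k + k)} :=
  puncture (shorten0 [set f i | i in 'I_k] S).

End Reindex.

(* pi_K(S) as a subspace of F^{2|K|}. *)
Definition puncture_set m (K : {set 'I_m}) (S : {vspace 'rV[F]_(m + m)}) :
    {vspace 'rV[F]_(#|K| + #|K|)} :=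
  puncture (fun i : 'I_#|K| => enum_val i) S.

(* (a|b) and (a'|b') combined into (a,a'|b,b'). *)
Definition glue n c (x : 'rV[F]_(n + n)) (y : 'rV[F]_(c + c)) :
    'rV[F]_((n + c) + (n + c)) :=
  row_mx (row_mx (lsubmx x) (lsubmx y)) (row_mx (rsubmx x) (rsubmx y)).

Definition repair_group n (C : {vspace 'rV[F]_(n + n)}) (I K : {set 'I_n}) :=
  puncture_set I (C + symp_orth C) =
  puncture_set I (shorten0 K (symp_orth C)).

Definition sufficient_observables n c
    (C' : {vspace 'rV[F]_((n + c) + (n + c))}) (I : {set 'I_n})
    (T : {set 'rV[F]_((n + c) + (n + c))}) : Prop :=
  (forall v, v \in T -> v \in symp_orth C') /\
  (forall e : 'rV[F]_((n + c) + (n + c)),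
     supp e \subset [set lshift c i | i in I] ->
     (forall v, v \in T -> symp e v = 0) -> e \in symp_orth C').

(* Matrices are passed to programs, and returned by them, as lists of rows. *)
Definition rows r m (B : 'M[F]_(r, m)) : seq 'rV[F]_m :=
  [seq row i B | i : 'I_r].

Definition mxrows m (B : seq 'rV[F]_m) : 'M[F]_(size B, m) :=
  \matrix_(i < size B) B`_i.

(* Column indices l and n+l of the qudits l in K. *)
Definition cols m (K : {set 'I_m}) : {set 'I_(m + m)} :=
  [set lshift m i | i in K] :|: [set rshift m i | i in K].

End Symplectic.

(* A computation returns its result together with the number of operations in
   F which it has performed.  The programs below inspect and combine elements
   of F only through subc, mulc, divc and zeroc, each of which counts for one
   operation; handling of indices, lists and sets is not an operation in F. *)
Definition counted (A : Type) : Type := (A * nat)%type.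
Definition run A (x : counted A) : A := x.1.
Definition steps A (x : counted A) : nat := x.2.
Definition ret A (a : A) : counted A := (a, 0%N).
Definition bind A B (x : counted A) (f : A -> counted B) : counted B :=
  (run (f (run x)), (steps x + steps (f (run x)))%N).

Notation "'let*' x := e1 'in' e2" := (bind e1 (fun x => e2))
  (at level 200, x pattern, e1 at level 200, e2 at level 200).

Section Programs.
Variable F : finFieldType.

Definition subc (x y : F) : counted F := (x - y, 1%N).
Definition mulc (x y : F) : counted F := (x * y, 1%N).
Definition divc (x y : F) : counted F := (x / y, 1%N).
Definition zeroc (x : F) : counted bool := (x == 0, 1%N).

Section Vectors.
Variable m : nat.

(* Computes only the coordinates in E, the other ones being known to vanish. *)
Definition tabulate (E : {set 'I_m}) (f : 'I_m -> counted F) : counted 'rV[F]_m :=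
  (\row_j (if j \in E then run (f j) else 0), \sum_(j in E) steps (f j)).

(* v - a u, for u and v vanishing outside E. *)
Definition row_op (E : {set 'I_m}) (a : F) (u v : 'rV[F]_m) : counted 'rV[F]_m :=
  tabulate E (fun j => let* t := mulc a (u 0 j) in subc (v 0 j) t).

(* The first index in js at which v is nonzero. *)
Fixpoint pivot (js : seq 'I_m) (v : 'rV[F]_m) : counted (option 'I_m) :=
  match js with
  | [::] => ret None
  | j :: js' =>
      let* b := zeroc (v 0 j) in if b then pivot js' v else ret (Some j)
  end.

(* A matrix in row echelon form is the list of its rows, each paired with its
   pivot position, by increasing pivots. *)
Definition echelon := seq ('I_m * 'rV[F]_m).

Definition insert (p : 'I_m) (u : 'rV[F]_m) (U : echelon) : echelon :=
  [seq x : 'I_m * 'rV[F]_m <- U | (x.1 < p)%N] ++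
  (p, u) :: [seq x : 'I_m * 'rV[F]_m <- U | (p < x.1)%N].

Fixpoint reduce (E : {set 'I_m}) (U : echelon) (v : 'rV[F]_m) :
    counted 'rV[F]_m :=
  match U with
  | [::] => ret v
  | (p, u) :: U' =>
      let* a := divc (v 0 p) (u 0 p) in
      let* v' := row_op E a u v in
      reduce E U' v'
  end.

Fixpoint reduce_all (E : {set 'I_m}) (U : echelon) (B : seq 'rV[F]_m) :
    counted (seq 'rV[F]_m) :=
  match B with
  | [::] => ret [::]
  | v :: B' =>
      let* v' := reduce E U v in
      let* R := reduce_all E U B' in
      ret (v' :: R)
  end.

(* Gaussian elimination with pivots in the columns D, on rows vanishing
   outside E.  Starting from the echelon form U, each row of B is reduced; the
   remainders which are nonzero on D are added to U and listed in N, those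
   which vanish on D are listed in Z. *)
Fixpoint eliminate (E D : {set 'I_m}) (U : echelon) (B : seq 'rV[F]_m) :
    counted (echelon * seq 'rV[F]_m * seq 'rV[F]_m) :=
  match B with
  | [::] => ret (U, [::], [::])
  | v :: B' =>
      let* r := reduce E U v in
      let* o := pivot (enum D) r in
      match o with
      | Some p =>
          let* (U', N, Z) := eliminate E D (insert p r U) B' in
          ret (U', r :: N, Z)
      | None =>
          let* (U', N, Z) := eliminate E D U B' in ret (U', N, r :: Z)
      end
  end.

End Vectors.

Section Reduction.
Variable n : nat.
Implicit Types (I K P : {set 'I_n}) (s : seq 'I_n).

(* Bases of sigma_I, V and sigma_{K\I} from a basis BK of sigma_K. *)
Definition decompose I K (BK : seq 'rV[F]_(n + n)) :
    counted (seq 'rV[F]_(n + n) * seq 'rV[F]_(n + n) * seq 'rV[F]_(n + n)) :=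
  let* (_, _, BW) := eliminate (cols K) (cols I) [::] BK in
  let* (_, _, BI) := eliminate (cols K) (cols (K :\: I)) [::] BK in
  let* (U, _, _) := eliminate (cols K) (cols K) [::] (BI ++ BW) in
  let* (_, BV, _) := eliminate (cols K) (cols K) U BK in
  ret (BI, BV, BW).

(* The columns of BW are handled as row vectors of length w.  The set of
   selected columns is cols P. *)
Definition greedy_step w (BW : 'M[F]_(w, n + n)) (l : 'I_n)
    (st : {set 'I_n} * echelon w) : counted ({set 'I_n} * echelon w) :=
  let: (P, U) := st in
  let* r1 := reduce setT U (col (lshift n l) BW)^T in
  let* o1 := pivot (enum 'I_w) r1 in
  match o1 with
  | None => ret (P, U)
  | Some p1 =>
      let U1 := insert p1 r1 U in
      let* r2 := reduce setT U1 (col (rshift n l) BW)^T in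
      let* o2 := pivot (enum 'I_w) r2 in
      match o2 with
      | None => ret (P, U)
      | Some p2 => ret (l |: P, insert p2 r2 U1)
      end
  end.

Fixpoint greedy_from w (BW : 'M[F]_(w, n + n)) s
    (st : {set 'I_n} * echelon w) : counted ({set 'I_n} * echelon w) :=
  match s with
  | [::] => ret st
  | l :: s' => let* st' := greedy_step BW l st in greedy_from BW s' st'
  end.

Definition greedy w (BW : 'M[F]_(w, n + n)) s : counted {set 'I_n} :=
  let* (P, _) := greedy_from BW s (set0, [::]) in ret P.

Fixpoint suppc s (u : 'rV[F]_(n + n)) : counted {set 'I_n} :=
  match s with
  | [::] => ret set0
  | l :: s' =>
      let* a := zeroc (u 0 (lshift n l)) in
      let* b := zeroc (u 0 (rshift n l)) in
      let* X := suppc s' u in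
      ret (if a && b then X else l |: X)
  end.

Fixpoint supps s (B : seq 'rV[F]_(n + n)) : counted {set 'I_n} :=
  match B with
  | [::] => ret set0
  | u :: B' =>
      let* X := suppc s u in
      let* Y := supps s B' in
      ret (X :|: Y)
  end.

(* The reduction procedure, run through the qudits of K\I in the order s, from
   a basis BK of sigma_K.  The rows M B_W to be subtracted in the elimination
   step are found by Gaussian elimination of B_W on the selected columns.
   Returns B_I, the reduced B_V, and J. *)
Definition reduction I K s (BK : seq 'rV[F]_(n + n)) :
    counted (seq 'rV[F]_(n + n) * seq 'rV[F]_(n + n) * {set 'I_n}) :=
  let* (BI, BV, BW) := decompose I K BK in
  let* P := greedy (mxrows BW) s in
  let* (U, _, _) := eliminate (cols K) (cols P) [::] BW in
  let* BVt := reduce_all (cols K) U BV in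
  let* X := supps (enum K) BVt in
  ret (BI, BVt, I :|: X).

Definition selected w (BW : 'M[F]_(w, n + n)) s : {set 'I_n} :=
  run (greedy BW s).

(* A legal sequence of choices in the procedure applied to S: the complement
   V, the bases B_I, B_V, B_W, the order s and the matrix M. *)
Definition reduction_choices (S : {vspace 'rV[F]_(n + n)}) I K rI rV rW
    (V : {vspace 'rV[F]_(n + n)})
    (BI : 'M[F]_(rI, n + n)) (BV : 'M[F]_(rV, n + n)) (BW : 'M[F]_(rW, n + n))
    s (M : 'M[F]_(rV, rW)) : Prop :=
  [/\ shorten0 K S = (shorten0 I S + shorten0 (K :\: I) S + V)%VS
        /\ directv (shorten0 I S + shorten0 (K :\: I) S + V),
      basis_of (shorten0 I S) (rows BI),
      basis_of V (rows BV),
      basis_of (shorten0 (K :\: I) S) (rows BW)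
    & perm_eq s (enum (K :\: I)) /\
      (forall j, j \in cols (selected BW s) -> col j (BV - M *m BW) = 0)].

Definition recovery_set I r (B : 'M[F]_(r, n + n)) : {set 'I_n} :=
  I :|: \bigcup_(u <- rows B) supp u.

End Reduction.

End Programs.

(* Main.v *)
(* Pair an error e supported in I with D, the symplectic dual of C.  By the
   repair condition the punctures to I of C + D and of sigma_K(D) agree, so e
   is orthogonal to C + D as soon as it is orthogonal to sigma_K(D); rows of
   B_W vanish on I, so orthogonality to the rows of B_I and of the reduced B_V
   suffices.  Then e lies in D and is orthogonal to D, and since (C')^perp is
   isotropic and alpha is onto, alpha e = 0, i.e. e padded by zeros is beta e.
   Conversely, an isotropic stabilizer forces every e that a sufficient set
   does not detect to be orthogonal to D, so the punctures to I of a sufficient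
   set span that of D, which bounds its size from below.
   The greedy step keeps the columns selected from B_W independent; hence
   elimination of B_W on these columns finds a pivot in each of them, and
   reduction of B_V clears them all. *)
Require Import Defs.
From mathcomp Require Import all_boot all_algebra zify ring.
Set Implicit Arguments.
Unset Strict Implicit.
Unset Printing Implicit Defensive.
Import GRing.Theory.
Local Open Scope ring_scope.

(** * Row spans and vanishing coordinates *)

Section SpanMatrix.
Variable (F : finFieldType).

Lemma size_rows r m (B : 'M[F]_(r, m)) : size (rows B) = r.
Proof. by rewrite size_map size_enum_ord. Qed.

Lemma nth_rows r m (B : 'M[F]_(r, m)) (i : 'I_r) : (rows B)`_i = row i B.
Proof. by rewrite (nth_map i) ?size_enum_ord // nth_ord_enum. Qed.

Lemma mxrowsK m (X : seq 'rV[F]_m) : rows (mxrows X) = X.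
Proof.
apply: (@eq_from_nth _ 0) => [|i]; rewrite size_rows // => iX.
rewrite (nth_rows (mxrows X) (Ordinal iX)).
by apply/rowP => j; rewrite !mxE.
Qed.

(** Carries facts between spans of vectors, the language of codes, and row spaces of matrices, where
    rank arguments are made. *)
Lemma mem_span_rows r m (B : 'M[F]_(r, m)) x :
  (x \in <<rows B>>%VS) = (x <= B)%MS.
Proof.
apply/idP/idP => [|/submxP [a ->]].
  move=> /(coord_span (X := in_tuple (rows B))) ->.
  apply: summx_sub => i _; apply: scalemx_sub.
  have iB : (i < r)%N by rewrite -[X in (_ < X)%N](size_rows B).
  by rewrite (nth_rows B (Ordinal iB)) row_sub.
rewrite mulmx_sum_row; apply: memv_suml => i _; apply: memvZ; apply: memv_span.
by apply/mapP; exists i; rewrite ?mem_enum.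
Qed.

Lemma mem_rows r m (B : 'M[F]_(r, m)) i : row i B \in rows B.
Proof. by apply/mapP; exists i; rewrite ?mem_enum. Qed.

Lemma free_rows r m (B : 'M[F]_(r, m)) : row_free B -> free (rows B).
Proof.
move=> fB; suff: free (Tuple (introT eqP (size_rows B))) by [].
apply/freeP => k; set s := \sum_(i < r) _ => s0 i.
have : (\row_i k i) *m B = 0.
  rewrite mulmx_sum_row -[RHS]s0; apply: eq_bigr => j _.
  by rewrite mxE (nth_rows B j).
move=> /eqP; rewrite mulmx_free_eq0 // => /eqP /rowP /(_ i).
by rewrite !mxE.
Qed.

Lemma dim_span_rows r m (B : 'M[F]_(r, m)) : \dim <<rows B>> = \rank B.
Proof.
have -> : <<rows B>>%VS = <<rows (row_base B)>>%VS.
  by apply/vspaceP => x; rewrite !mem_span_rows eq_row_base.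
have /eqP -> := free_rows (row_base_free B).
by rewrite size_rows.
Qed.

End SpanMatrix.

Section Zeros.
Variables (F : finFieldType) (m : nat).
Implicit Types (E D : {set 'I_m}) (x : 'rV[F]_m).

(** Encoded as the kernel of column extraction, so that injectivity of the extraction on a subspace,
    or its vanishing there, becomes a statement about meeting or lying in [zeros E]. *)
Definition zeros E : {vspace 'rV[F]_m} :=
  lker (linfun (colsub (fun i : 'I_#|E| => enum_val i))).

Lemma zerosP E x : reflect (forall j, j \in E -> x 0 j = 0) (x \in zeros E).
Proof.
rewrite memv_ker lfunE /=; apply: (iffP eqP) => [/rowP x0 j jE|x0].
  by move/(_ (enum_rank_in jE j)): x0; rewrite !mxE enum_rankK_in.
by apply/rowP => j; rewrite !mxE x0 // enum_valP.
Qed.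

Lemma zerosS E D : E \subset D -> (zeros D <= zeros E)%VS.
Proof.
move=> /subsetP sED; apply/subvP => x /zerosP x0.
by apply/zerosP => j /sED /x0.
Qed.

Lemma zerosU E D : zeros (E :|: D) = (zeros E :&: zeros D)%VS.
Proof.
apply/vspaceP => x; rewrite memv_cap; apply/zerosP/andP.
  by move=> x0; split; apply/zerosP => j jE; rewrite x0 // inE jE ?orbT.
by move=> [/zerosP xE /zerosP xD] j /setUP [/xE|/xD].
Qed.

Lemma zerosT : zeros setT = 0%VS.
Proof.
apply/vspaceP => x; rewrite memv0; apply/zerosP/eqP => [x0|-> j _];
  last by rewrite mxE.
by apply/rowP => j; rewrite mxE x0 ?inE.
Qed.

Lemma zeros0 x : x \in zeros set0.
Proof. by apply/zerosP => j; rewrite inE. Qed.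

(** Extraction of the columns in [E] is injective on [U]: a vector of [U] in its kernel vanishes
    both on [E] and on the complement. *)
Lemma dim_zeros_outside E (U : {vspace 'rV[F]_m}) :
  (U <= zeros (~: E))%VS -> (\dim U <= #|E|)%N.
Proof.
move=> sU; set f : 'Hom('rV[F]_m, 'rV[F]_#|E|) :=
  linfun (colsub (fun i : 'I_#|E| => enum_val i)).
have <- : \dim (f @: U) = \dim U.
  apply: limg_dim_eq; apply/eqP; rewrite -subv0 -zerosT -(setUCr E) zerosU capvC.
  by rewrite capvS.
apply: leq_trans (dimvS (subvf _)) _; by rewrite dimvf dim_matrix mul1r.
Qed.

End Zeros.

(** * Column sets of qudits and supports *)

Section Cols.
Variables (F : finFieldType) (n : nat).
Implicit Types (K : {set 'I_n}) (x : 'rV[F]_(n + n)) (S : {vspace 'rV[F]_(n + n)}).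

Lemma mem_cols_l K i : (lshift n i \in cols K) = (i \in K).
Proof.
apply/idP/idP => [|iK]; last by apply/setUP; left; apply: imset_f.
case/setUP => /imsetP [j jK /eqP]; last by rewrite eq_lrshift.
by rewrite (inj_eq (@lshift_inj _ _)) => /eqP ->.
Qed.

Lemma mem_cols_r K i : (rshift n i \in cols K) = (i \in K).
Proof.
apply/idP/idP => [|iK]; last by apply/setUP; right; apply: imset_f.
case/setUP => /imsetP [j jK /eqP]; first by rewrite eq_rlshift.
by rewrite (inj_eq (@rshift_inj _ _)) => /eqP ->.
Qed.

Lemma colsC K : cols (~: K) = ~: cols K.
Proof.
apply/setP => j; rewrite in_setC.
by case: (split_ordP j) => i ->; rewrite ?mem_cols_l ?mem_cols_r inE.
Qed.

Lemma colsU K L : cols (K :|: L) = cols K :|: cols L.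
Proof.
apply/setP => j; rewrite in_setU.
by case: (split_ordP j) => i ->; rewrite ?mem_cols_l ?mem_cols_r inE.
Qed.

Lemma colsT : cols [set: 'I_n] = setT.
Proof.
apply/setP => j.
by case: (split_ordP j) => i ->; rewrite ?mem_cols_l ?mem_cols_r !inE.
Qed.

Lemma card_cols K : #|cols K| = (2 * #|K|)%N.
Proof.
rewrite cardsU !card_imset; try exact: lshift_inj; try exact: rshift_inj.
rewrite [X in #|pred_of_set X|](_ : _ = set0) ?cards0 ?mul2n ?addnn ?subn0 //.
apply/setP => j; rewrite !inE; apply/negP.
case/andP => /imsetP [i _ ->] /imsetP [k _ /eqP].
by rewrite eq_lrshift.
Qed.

Lemma notin_supp x i :
  (i \notin supp x) = (x 0 (lshift n i) == 0) && (x 0 (rshift n i) == 0).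
Proof. by rewrite inE negbK. Qed.

Lemma zeros_colsE K x : (x \in zeros F (cols K)) = (supp x \subset ~: K).
Proof.
apply/zerosP/subsetP => [x0 i|sx j].
  apply: contraTT; rewrite inE negbK notin_supp => iK.
  by rewrite !x0 ?mem_cols_l ?mem_cols_r ?eqxx.
have out i : i \in K -> (x 0 (lshift n i) == 0) && (x 0 (rshift n i) == 0).
  by rewrite -notin_supp => iK; apply: contraL iK => /sx; rewrite inE.
by case: (split_ordP j) => i ->; rewrite ?mem_cols_l ?mem_cols_r;
  case/out/andP => /eqP ? /eqP ?.
Qed.

Lemma supportedE K : supported F K = zeros F (cols (~: K)).
Proof. by apply/vspaceP => x; rewrite mem_supported zeros_colsE setCK. Qed.

End Cols.

(** * Reduction against an echelon form *)

Arguments run [A] x : simpl never.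
Arguments steps [A] x : simpl never.
Arguments bind [A B] x f : simpl never.

Lemma run_bind A B (x : counted A) (f : A -> counted B) :
  run (bind x f) = run (f (run x)).
Proof. by []. Qed.

Lemma steps_bind A B (x : counted A) (f : A -> counted B) :
  steps (bind x f) = (steps x + steps (f (run x)))%N.
Proof. by []. Qed.

Lemma run_ret A (x : A) : run (ret x) = x.
Proof. by []. Qed.

Lemma steps_ret A (x : A) : steps (ret x) = 0%N.
Proof. by []. Qed.

Section Echelon.
Variables (F : finFieldType) (m : nat).
Implicit Types (E D : {set 'I_m}) (u v r : 'rV[F]_m) (U : echelon F m)
  (B : seq 'rV[F]_m).

Local Notation ltp := (fun x y : 'I_m * 'rV[F]_m => (x.1 < y.1)%N).
Local Notation vecs := (map snd).

(** [E] bounds the support of the rows, while pivots are sought in [D] only. Rows may be nonzero at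
    later pivots: the form is triangular, not fully reduced. *)
Definition echelon_form E D U : Prop :=
  pairwise ltp U /\
  forall x, x \in U ->
    [/\ x.1 \in D, x.2 \in zeros F (~: E), x.2 0 x.1 != 0
      & forall j, j \in D -> (j < x.1)%N -> x.2 0 j = 0].

(** Later rows have later pivots and vanish on [D] before them, hence at the first pivot. The
    inductions on [U] below peel off its first row in this way. *)
Lemma echelon_form_cons E D x U :
  echelon_form E D (x :: U) ->
  echelon_form E D U /\ (forall y, y \in U -> y.2 0 x.1 = 0).
Proof.
case=> /= /andP [/allP ltU pwU] fU; split.
  by split=> // y yU; apply: fU; rewrite inE yU orbT.
move=> y yU; have [_ _ _] := fU y (mem_behead (s := x :: U) yU).
by apply; [have [] := fU x (mem_head _ _)|apply: ltU].
Qed.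

Lemma echelon_form_zeros E D U :
  echelon_form E D U -> (<<vecs U>> <= zeros F (~: E))%VS.
Proof.
by move=> [_ fU]; apply/span_subvP => _ /mapP [x /fU [_ ? _ _] ->].
Qed.

(** At the first pivot only the first row contributes, so its coefficient is zero; induction deals
    with the other rows. *)
Lemma echelon_form_eq0 E D U v :
    echelon_form E D U -> v \in <<vecs U>>%VS ->
  (forall x, x \in U -> v 0 x.1 = 0) -> v = 0.
Proof.
elim: U v => [v _|x U IH v eU]; first by rewrite span_nil memv0 => /eqP.
have [eU' U0] := echelon_form_cons eU.
rewrite span_cons => /memv_addP [_ /vlineP [a ->]] [w wU ->] v0.
have w0 : w 0 x.1 = 0.
  rewrite (coord_span (X := in_tuple (vecs U)) wU) summxE big1 // => i _.
  have /mapP [y /U0 y0 ->] := mem_nth 0 (ltn_ord i : (i < size (vecs U))%N).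
  by rewrite mxE y0 mulr0.
have /eqP := v0 x (mem_head _ _); rewrite !mxE w0 addr0 mulf_eq0.
have [_ _ /negPf ->] := proj2 eU x (mem_head _ _).
rewrite orbF => _ /eqP a0; move: v0; rewrite a0 scale0r add0r => v0.
by apply: IH => // y yU; apply: v0; rewrite inE yU orbT.
Qed.

(** A first row in the span of the others would vanish at its own pivot. *)
Lemma echelon_form_free E D U : echelon_form E D U -> free (vecs U).
Proof.
elim: U => [|x U IH] eU /=; first exact: nil_free.
have [eU' U0] := echelon_form_cons eU; rewrite free_cons IH // andbT.
have [_ _ + _] := proj2 eU x (mem_head _ _); apply: contraNN => xU.
rewrite (coord_span (X := in_tuple (vecs U)) xU) summxE big1 // => i _.
have /mapP [y /U0 y0 ->] := mem_nth 0 (ltn_ord i : (i < size (vecs U))%N).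
by rewrite mxE y0 mulr0.
Qed.

Lemma uniq_pivots E D U : echelon_form E D U -> uniq (map fst U).
Proof.
move=> [pU _]; apply: (@pairwise_uniq _ (fun i j : 'I_m => (i < j)%N)).
  by move=> i; rewrite ltnn.
by rewrite pairwise_map.
Qed.

(** Leaving out the coordinates outside [E] is harmless, since both vectors vanish there. *)
Lemma run_row_op E a u v :
  u \in zeros F (~: E) -> v \in zeros F (~: E) ->
  run (row_op E a u v) = v - a *: u.
Proof.
move=> /zerosP u0 /zerosP v0; apply/rowP => j; rewrite !mxE /=.
by case: ifPn => // jE; rewrite u0 ?v0 ?inE // mulr0 subr0.
Qed.

Lemma run_reduce_cons E p u U v :
  run (reduce E ((p, u) :: U) v) =
  run (reduce E U (run (row_op E (v 0 p / u 0 p) u v))).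
Proof. by []. Qed.

Lemma reduce_sub_span E U v :
    (<<vecs U>> <= zeros F (~: E))%VS -> v \in zeros F (~: E) ->
  v - run (reduce E U v) \in <<vecs U>>%VS.
Proof.
elim: U v => [v _ _|[p u] U IH v]; first by rewrite subrr mem0v.
rewrite run_reduce_cons span_cons subv_add => /andP [su sU] v0.
have u0 : u \in zeros F (~: E) by apply: subvP su _ (memv_line u).
rewrite run_row_op //; set w := v - _ *: u.
rewrite -[X in X - _](subrK w) -addrA memv_add //.
  by rewrite /w subKr memvZ // memv_line.
by apply: IH; rewrite // rpredB // memvZ.
Qed.

Lemma reduce_zeros E U v :
    (<<vecs U>> <= zeros F (~: E))%VS -> v \in zeros F (~: E) ->
  run (reduce E U v) \in zeros F (~: E).
Proof.
move=> sU v0; rewrite -[run _](subKr v) rpredB //.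
exact: subvP sU _ (reduce_sub_span sU v0).
Qed.

Lemma reduce_keep E U v j :
    (<<vecs U>> <= zeros F (~: E))%VS -> v \in zeros F (~: E) ->
    (forall x, x \in U -> x.2 0 j = 0) ->
  run (reduce E U v) 0 j = v 0 j.
Proof.
elim: U v => // -[p u] U IH v.
rewrite run_reduce_cons [map _ _]/= span_cons subv_add => /andP [su sU] v0 Uj.
have u0 : u \in zeros F (~: E) by apply: subvP su _ (memv_line u).
rewrite run_row_op // IH ?rpredB ?memvZ //.
  by rewrite !mxE (Uj (p, u)) ?mem_head // mulr0 subr0.
by move=> x xU; apply: Uj; rewrite inE xU orbT.
Qed.

(** Each row clears its own pivot, and the rows used afterwards vanish there, so the entry stays
    zero ([reduce_keep]). One pass by increasing pivots is thus enough. *)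
Lemma reduce_pivots E D U v x :
    echelon_form E D U -> v \in zeros F (~: E) -> x \in U ->
  run (reduce E U v) 0 x.1 = 0.
Proof.
elim: U v => // -[p u] U IH v eU v0.
have [eU' U0] := echelon_form_cons eU.
have sU := echelon_form_zeros eU'.
have [_ u0 up _] := proj2 eU (p, u) (mem_head _ _).
have w0 a : v - a *: u \in zeros F (~: E) by rewrite rpredB // memvZ.
rewrite run_reduce_cons run_row_op // inE.
case/predU1P => [->|xU]; last exact: IH.
by rewrite reduce_keep // !mxE divfK // subrr.
Qed.

(** [enum D] lists indices increasingly, so the first nonzero entry met has the least index. *)
Lemma pivot_notNone D v p :
  run (pivot (enum D) v) = Some p ->
  [/\ p \in D, v 0 p != 0 & forall j, j \in D -> (j < p)%N -> v 0 j = 0].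
Proof.
have: pairwise (fun i j : 'I_m => (i < j)%N) (enum D).
  apply: pairwise_filter; rewrite -enumT.
  have: pairwise ltn (map val (enum 'I_m)).
    by rewrite val_enum_ord -(sorted_pairwise ltn_trans) iota_ltn_sorted.
  by rewrite pairwise_map.
have -> : (p \in D) = (p \in enum D) by rewrite mem_enum.
have e j : (j \in D) = (j \in enum D) by rewrite mem_enum.
move=> lt_js pD.
suff [? ? jD]: [/\ p \in enum D, v 0 p != 0
    & forall j, j \in enum D -> (j < p)%N -> v 0 j = 0].
  by split=> // j; rewrite e; apply: jD.
elim: (enum D) lt_js pD => //= i js IH /andP [/allP ijs lt_js].
rewrite run_bind /=; case: ifPn => [/eqP vi /IH [] // pjs vp js0|vi [<-]].
  split=> // [|j]; first by rewrite inE pjs orbT.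
  by rewrite inE => /predU1P [->//|/js0].
split=> // [|j]; first by rewrite mem_head.
rewrite inE => /predU1P [->|/ijs]; first by rewrite ltnn.
by move=> ij ji; rewrite ltnNge ltnW in ji.
Qed.

Lemma pivot_None D v : run (pivot (enum D) v) = None -> v \in zeros F D.
Proof.
move=> pN; suff js0 j : j \in enum D -> v 0 j = 0.
  by apply/zerosP => j jD; apply: js0; rewrite mem_enum.
elim: (enum D) pN => //= i js IH; rewrite run_bind.
case: ifPn => // /eqP vi /IH js0.
by rewrite inE => /predU1P [->|/js0].
Qed.

(* The entry of U at pivot p, if any, would be dropped by the insertion. *)
Lemma perm_insert U p r :
  (forall x, x \in U -> x.1 != p) -> perm_eq (insert p r U) ((p, r) :: U).
Proof.
move=> Up; rewrite /insert perm_catC /= perm_cons perm_catC.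
have -> : [seq x : 'I_m * 'rV[F]_m <- U | (p < x.1)%N] =
    [seq x : 'I_m * 'rV[F]_m <- U | ~~ (x.1 < p)%N].
  by apply: eq_in_filter => x /Up xp; rewrite -leqNgt ltn_neqAle eq_sym xp.
exact: permEl (perm_filterC _ U).
Qed.

Lemma mem_insert U p r x :
  (x \in insert p r U) = (x == (p, r)) || ((x \in U) && (x.1 != p)).
Proof.
by rewrite mem_cat inE !mem_filter (neq_ltn (nat_of_ord x.1));
  case: (x == _); case: (x \in U); rewrite /= ?orbT ?orbF ?andbF ?andbT.
Qed.

(** [r] vanishes at the old pivots but not at [p], so [p] is new and the insertion drops no row. Old
    rows with smaller pivots may be nonzero at [p], which the triangular form allows. *)
Lemma echelon_form_insert E D U p r :
    echelon_form E D U -> r \in zeros F (~: E) ->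
    (forall x, x \in U -> r 0 x.1 = 0) ->
    [/\ p \in D, r 0 p != 0 & forall j, j \in D -> (j < p)%N -> r 0 j = 0] ->
  echelon_form E D (insert p r U) /\
  perm_eq (vecs (insert p r U)) (r :: vecs U).
Proof.
move=> [pU fU] r0 rU [pD rp lt_p].
have Up x : x \in U -> x.1 != p.
  by move=> /rU xr; apply: contraNneq rp => <-; rewrite xr.
split; last exact: (perm_map snd (perm_insert r Up)).
split; last first.
  by move=> x; rewrite mem_insert => /orP [/eqP -> //|/andP [/fU]].
rewrite pairwise_cat /= !pairwise_filter // ?andbT.
apply/andP; split; last first.
  by apply/allP => x; rewrite mem_filter => /andP [].
apply/allrelP => x y; rewrite mem_filter => /andP [xp _].
rewrite inE => /predU1P [->//|]; rewrite mem_filter => /andP [py _].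
exact: ltn_trans xp py.
Qed.

Lemma addv_line_congr (S : {vspace 'rV[F]_m}) v r :
  v - r \in S -> (S + <[v]>)%VS = (S + <[r]>)%VS.
Proof.
have half x y : x - y \in S -> (S + <[x]> <= S + <[y]>)%VS.
  move=> xy; rewrite subv_add addvSl -memvE -[x](subrK y).
  by rewrite memv_add ?memv_line.
by move=> vr; apply: subv_anti; rewrite !half // -opprB rpredN.
Qed.

(** Replacing a row by its remainder changes it by an element of the span of the current echelon
    form, so the total span is preserved. The equation on sizes later turns spanning into
    freeness. *)
Lemma eliminate_spec E D U B U' N Z :
    echelon_form E D U -> (<<B>> <= zeros F (~: E))%VS ->
    run (eliminate E D U B) = (U', N, Z) ->
  [/\ [/\ echelon_form E D U', perm_eq (vecs U') (vecs U ++ N)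
        & (size N + size Z)%N = size B],
      (<<Z>> <= zeros F (~: E :|: D))%VS
    & <<vecs U ++ N ++ Z>>%VS = <<vecs U ++ B>>%VS].
Proof.
elim: B U U' N Z => [|v B IH] U U' N Z eU.
  by move=> _ [<- <- <-]; rewrite cats0 span_nil sub0v.
rewrite span_cons subv_add -memvE => /andP [v0 sB].
have sU := echelon_form_zeros eU.
have vr := reduce_sub_span sU v0; have r0 := reduce_zeros sU v0.
have rU x : x \in U -> _ := reduce_pivots eU v0.
rewrite /= run_bind; move: vr r0 rU; set r := run (reduce _ _ _) => vr r0 rU.
have spanE : <<vecs U ++ v :: B>>%VS = <<r :: vecs U ++ B>>%VS.
  rewrite !(span_cons, span_cat) addvA (addv_line_congr vr).
  by rewrite addvA (addvC <<_>>%VS <[r]>%VS).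
rewrite run_bind; case pr: (run (pivot _ _)) => [p|].
  rewrite run_bind; case e: (run (eliminate _ _ _ _)) => [[U1 N1] Z1] [<- <- <-].
  have [eUp permUp] := echelon_form_insert eU r0 rU (pivot_notNone pr).
  have [[eU1 permU1 <-] sZ sp] := IH _ _ _ _ eUp sB e.
  split=> //.
    split=> //; rewrite (perm_trans permU1) // perm_sym (perm_catCA _ [:: r]).
    by rewrite [[:: r] ++ _]/= -cat_cons perm_cat2r perm_sym.
  rewrite spanE.
  have pe B' : <<r :: vecs U ++ B'>>%VS = <<vecs (insert p r U) ++ B'>>%VS.
    apply: eq_span; apply: perm_mem.
    by rewrite -(cat_cons r) perm_cat2r perm_sym.
  rewrite pe -sp -pe; apply: eq_span; apply: perm_mem.
  by rewrite (perm_catCA _ [:: r]).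
rewrite run_bind; case e: (run (eliminate _ _ _ _)) => [[U1 N1] Z1] [<- <- <-].
have [[eU1 permU1 <-] sZ sp] := IH _ _ _ _ eU sB e.
split=> //.
- by split=> //; rewrite /= addnS.
- by rewrite span_cons subv_add sZ andbT -memvE zerosU memv_cap r0 pivot_None.
rewrite spanE span_cons -sp -span_cons; apply: eq_span; apply: perm_mem.
by rewrite catA (perm_catCA _ [:: r]) -catA.
Qed.

Lemma run_reduce_all E U B :
  run (reduce_all E U B) = [seq run (reduce E U v) | v <- B].
Proof. by elim: B => //= v B IH; rewrite !run_bind /= -IH. Qed.

End Echelon.

(** * Operation counts *)

Section Steps.
Variables (F : finFieldType).

Section Elimination.
Variable m : nat.
Implicit Types (E D : {set 'I_m}) (u v r : 'rV[F]_m) (U : echelon F m)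
  (B : seq 'rV[F]_m).

Lemma steps_reduce E U v :
  steps (reduce E U v) = (size U * (1 + 2 * #|E|))%N.
Proof.
elim: U v => // -[p u] U IH v.
rewrite [reduce _ _ _]/= !steps_bind IH mulSn addnA; congr (_ + _ + _)%N.
by rewrite [LHS](eq_bigr (fun=> 2%N)) // sum_nat_const mulnC.
Qed.

Lemma steps_pivot (js : seq 'I_m) v : (steps (pivot js v) <= size js)%N.
Proof.
elim: js => //= j js IH; rewrite steps_bind /=.
by case: ifP.
Qed.

Lemma size_insert p r U : (size (insert p r U) <= (size U).+1)%N.
Proof.
rewrite size_cat /= addnS ltnS !size_filter.
rewrite -(count_predC (fun x : 'I_m * 'rV[F]_m => (x.1 < p)%N) U) leq_add2l.
by apply: sub_count => x /= px; rewrite -leqNgt ltnW.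
Qed.

(** Each row of [B] meets at most [size U + size B] echelon rows, at one division and two operations
    per column of [E] each, and is then scanned on [D]. *)
Lemma eliminate_size_steps E D U B :
  [/\ (size (run (eliminate E D U B)).1.1 <= size U + size B)%N,
      (size (run (eliminate E D U B)).1.2 + size (run (eliminate E D U B)).2
        = size B)%N
    & (steps (eliminate E D U B) <=
        size B * ((size U + size B) * (1 + 2 * #|E|) + #|D|))%N].
Proof.
(* Induction step of the count: [e] is the cost of one row operation, [d] bounds the scan cost [p],
   [sI] is the length of the echelon form passed on, and [a] is the cost of the remaining rows. *)
have bound sU sI sB e d a p : (sI <= sU.+1 -> p <= d ->
    a <= sB * ((sI + sB) * e + d) ->
    sU * e + (p + a) <= sB.+1 * ((sU + sB.+1) * e + d))%N.
  move=> sI1 pd; set X := ((sU + sB.+1) * e + d)%N => aX.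
  have h1 : ((sI + sB) * e + d <= X)%N by rewrite leq_add2r leq_mul2r; lia.
  have h2 : (sU * e + d <= X)%N by rewrite leq_add2r leq_mul2r; lia.
  by have := leq_trans aX (leq_mul (leqnn sB) h1); rewrite mulSn; lia.
elim: B U => [|v B IH] U; first by split; rewrite //= addn0.
rewrite [eliminate _ _ _ _]/= !run_bind !steps_bind steps_reduce.
have := steps_pivot (enum D) (run (reduce E U v)); rewrite -cardE.
move: (1 + 2 * #|E|)%N IH => e IH.
case: (run (pivot _ _)) => [p|]; rewrite run_bind steps_bind.
  have := size_insert p (run (reduce E U v)) U.
  have [] := IH (insert p (run (reduce E U v)) U).
  case: (run (eliminate _ _ _ _)) => [[U' N] Z] /= sU' sNZ st sI stp.
  by split; [lia|lia|rewrite addn0; apply: bound stp st].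
have [] := IH U.
case: (run (eliminate _ _ _ _)) => [[U' N] Z] /= sU' sNZ st stp.
by split; [lia|lia|rewrite addn0; apply: bound stp st].
Qed.

Lemma steps_reduce_all E U B :
  steps (reduce_all E U B) = (size B * (size U * (1 + 2 * #|E|)))%N.
Proof.
elim: B => //= v B IH.
by rewrite !steps_bind steps_reduce IH steps_ret addn0 mulSn.
Qed.

End Elimination.

Section Qudits.
Variable n : nat.
Implicit Types (s : seq 'I_n).

Lemma steps_supps s (B : seq 'rV[F]_(n + n)) :
  steps (supps s B) = (size B * (2 * size s))%N.
Proof.
have suppcE u : steps (suppc s u) = (2 * size s)%N.
  elim: s => //= l s IH; rewrite !steps_bind IH steps_ret.
  by rewrite -![steps (zeroc _)]/1%N; lia.
elim: B => //= u B IH.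
by rewrite !steps_bind suppcE IH steps_ret addn0 mulSn.
Qed.

(** Two reductions against at most [size U + 1] rows of length [w], each followed by a scan of at
    most [w] entries. *)
Lemma greedy_step_size_steps w (BW : 'M[F]_(w, n + n)) l P (U : echelon F w) :
  let t := greedy_step BW l (P, U) in
  (size (run t).2 <= size U + 2)%N /\
  (steps t <= 2 * ((size U + 1) * (1 + 2 * w) + w))%N.
Proof.
rewrite /greedy_step !run_bind !steps_bind steps_reduce cardsT card_ord.
have := steps_pivot (enum 'I_w) (run (reduce setT U (col (lshift n l) BW)^T)).
rewrite size_enum_ord.
have mono k : (k <= size U + 1 ->
    k * (1 + 2 * w) <= (size U + 1) * (1 + 2 * w))%N.
  by move=> kU; rewrite leq_mul2r kU orbT.
have mU := mono _ (leq_addr 1 (size U)).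
case: (run (pivot _ _)) => [p1|] st1; last by rewrite run_ret steps_ret /=; lia.
have sI := size_insert p1 (run (reduce setT U (col (lshift n l) BW)^T)) U.
rewrite !run_bind !steps_bind steps_reduce cardsT card_ord.
set U1 := insert _ _ _ in sI *.
have := steps_pivot (enum 'I_w) (run (reduce setT U1 (col (rshift n l) BW)^T)).
rewrite size_enum_ord.
have mU1 : (size U1 * (1 + 2 * w) <= (size U + 1) * (1 + 2 * w))%N.
  by apply: mono; rewrite addn1.
case: (run (pivot _ _)) => [p2|] st2; rewrite run_ret steps_ret /=; last by lia.
have := size_insert p2 (run (reduce setT U1 (col (rshift n l) BW)^T)) U1.
by lia.
Qed.

(** Each qudit adds at most two rows, so the echelon form never exceeds [size U + 2 * size s]
    rows. *)
Lemma steps_greedy_from w (BW : 'M[F]_(w, n + n)) s P (U : echelon F w) :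
  (steps (greedy_from BW s (P, U)) <=
    size s * (2 * ((size U + 2 * size s) * (1 + 2 * w) + w)))%N.
Proof.
elim: s P U => // l s IH P U.
rewrite -[greedy_from _ _ _]/(bind (greedy_step BW l (P, U)) (greedy_from BW s)).
rewrite steps_bind.
have [] := greedy_step_size_steps BW l P U.
case: (run _) => P' U' sU' st; move: sU' => /= sU'; have := IH P' U'.
set e := (1 + 2 * w)%N in st *.
set X := ((size U + 2 * (size s).+1) * e + w)%N => IHX.
have h1 : ((size U + 1) * e + w <= X)%N by rewrite leq_add2r leq_mul2r; lia.
have h2 : ((size U' + 2 * size s) * e + w <= X)%N.
  by rewrite leq_add2r leq_mul2r; lia.
rewrite (mulSn (size s)); apply: leq_add.
  by apply: leq_trans st (leq_mul (leqnn 2) h1).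
exact: leq_trans IHX (leq_mul (leqnn _) (leq_mul (leqnn 2) h2)).
Qed.

End Qudits.

End Steps.

(** * Greedy selection and decomposition *)

Section EliminationCorrect.
Variables (F : finFieldType) (m : nat).
Implicit Types (E D : {set 'I_m}) (U : echelon F m) (B N Z : seq 'rV[F]_m).

Lemma echelon_form_nil E D : echelon_form E D ([::] : echelon F m).
Proof. by split. Qed.

(** [N] and [Z] together span the span of [B] and have as many vectors, so they are free. If a sum
    of [y] in the span of [N] and [z] in that of [Z] vanishes on [D], so does [y], which is then
    zero by its pivots. Shortened codes are computed as such kernels. *)
Lemma eliminate_kernel E D B U N Z :
    free B -> (<<B>> <= zeros F (~: E))%VS ->
    run (eliminate E D [::] B) = (U, N, Z) ->
  basis_of (<<B>> :&: zeros F D) Z.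
Proof.
move=> fB sB e.
have [[eU pU sz] sZ /= spB] := eliminate_spec (echelon_form_nil E D) sB e.
have sNU : <<N>>%VS = <<map snd U>>%VS.
  by apply: eq_span => x; rewrite (perm_mem pU).
rewrite /basis_of eqEsubv -andbA; apply/and3P; split; last 1 first.
- apply: (@catr_free _ _ N).
  by rewrite /free spB size_cat sz; apply: fB.
- rewrite subv_cap -spB span_cat addvSr /=.
  by apply: subv_trans sZ (zerosS _ (subsetUr _ _)).
apply/subvP => x; rewrite memv_cap -spB span_cat => /andP [/memv_addP].
case=> y yN [z zZ ->] yz0.
have zD : z \in zeros F D.
  exact: subvP (subv_trans sZ (zerosS _ (subsetUr _ _))) _ zZ.
have yD : y \in zeros F D by rewrite -(rpredDr y zD).
suff -> : y = 0 by rewrite add0r.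
apply: (echelon_form_eq0 eU); first by rewrite -sNU.
by move=> u uU; have [uD _ _ _] := proj2 eU u uU; move/zerosP: yD; apply.
Qed.

(** With pivots allowed in all of [E], the vectors of [Z] vanish everywhere, so [N] completes the
    span of [U] to the sum. As the rows of [U'] are free, [N] is a basis of a complement. *)
Lemma eliminate_complement E U B U' N Z :
    echelon_form E E U -> (<<B>> <= zeros F (~: E))%VS ->
    run (eliminate E E U B) = (U', N, Z) ->
  [/\ echelon_form E E U', perm_eq (map snd U') (map snd U ++ N)
    & <<map snd U'>>%VS = (<<map snd U>> + <<B>>)%VS].
Proof.
move=> eU sB e.
have [[eU' pU' _] sZ sp] := eliminate_spec eU sB e.
split=> //; rewrite -span_cat -sp catA span_cat.
rewrite (eq_span (perm_mem pU')); apply/eqP; rewrite eq_sym; apply/eqP/addv_idPl.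
by apply: subv_trans sZ _; rewrite setUC setUCr zerosT sub0v.
Qed.

(** Restriction to [D] kills [Z], so the [#|D|] independent columns force at least [#|D|] echelon
    rows. Their pivots are distinct elements of [D], hence exhaust it. *)
Lemma eliminate_pivots E D B U N Z :
    (<<B>> <= zeros F (~: E))%VS ->
    \rank (colsub (fun i : 'I_#|D| => enum_val i) (mxrows B)) = #|D| ->
    run (eliminate E D [::] B) = (U, N, Z) ->
  forall j, j \in D -> exists2 x, x \in U & x.1 = j.
Proof.
move=> sB rkB e.
have [[eU pU sz] sZ /= spB] := eliminate_spec (echelon_form_nil E D) sB e.
have sNU : <<N>>%VS = <<map snd U>>%VS.
  by apply: eq_span => x; rewrite (perm_mem pU).
have szU : (#|D| <= size U)%N.
  rewrite -rkB -dim_span_rows.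
  set f : 'Hom('rV[F]_m, 'rV[F]_#|D|) :=
    linfun (colsub (fun i : 'I_#|D| => enum_val i)).
  have -> : <<rows (colsub (fun i : 'I_#|D| => enum_val i) (mxrows B))>>%VS =
      (f @: <<B>>)%VS.
    rewrite -[in RHS](mxrowsK B) limg_span; congr <<_>>%VS.
    rewrite -map_comp; apply: eq_map => i /=.
    by apply/rowP => j; rewrite lfunE !mxE.
  rewrite -spB span_cat limgD sNU.
  have -> : (f @: <<Z>>)%VS = 0%VS.
    apply/eqP; rewrite -lkerE.
    by apply: subv_trans sZ (zerosS _ (subsetUr _ _)).
  rewrite addv0 limg_span (leq_trans (dim_span _)) //.
  by rewrite !size_map.
have UD : {subset map fst U <= enum D}.
  by move=> _ /mapP [x /(proj2 eU) [xD _ _ _] ->]; rewrite mem_enum.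
have [|_ UE] := uniq_min_size (uniq_pivots eU) UD.
  by rewrite -cardE size_map.
move=> j; rewrite -mem_enum -UE => /mapP [x xU ->].
by exists x.
Qed.

Lemma span_insert E D U v p (r := run (reduce E U v)) :
    echelon_form E D U -> v \in zeros F (~: E) ->
    run (pivot (enum D) r) = Some p ->
  echelon_form E D (insert p r U) /\
  <<map snd (insert p r U)>>%VS = (<<map snd U>> + <[v]>)%VS.
Proof.
move=> eU v0 pr; have sU := echelon_form_zeros eU.
have [eI pI] := echelon_form_insert eU (reduce_zeros sU v0)
  (fun x => reduce_pivots eU v0 (x := x)) (pivot_notNone pr).
split=> //; rewrite (eq_span (perm_mem pI)) span_cons addvC.
by rewrite -(addv_line_congr (reduce_sub_span sU v0)).
Qed.

End EliminationCorrect.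

Section GreedyCorrect.
Variables (F : finFieldType) (n w : nat) (BW : 'M[F]_(w, n + n)).
Implicit Types (P : {set 'I_n}) (U : echelon F w) (s : seq 'I_n).

Definition colspan (J : {set 'I_(n + n)}) : {vspace 'rV[F]_w} :=
  (\sum_(j in J) <[(col j BW)^T]>)%VS.

Lemma colspan_setU1 l P :
  l \notin P ->
  colspan (cols (l |: P)) =
  (colspan (cols P) + <[(col (lshift n l) BW)^T]>
                    + <[(col (rshift n l) BW)^T]>)%VS.
Proof.
move=> lP; rewrite /colspan.
have -> : cols (l |: P) = lshift n l |: (rshift n l |: cols P).
  apply/setP => j; rewrite !in_setU1.
  case: (split_ordP j) => i ->; rewrite ?mem_cols_l ?mem_cols_r in_setU1.
    by rewrite (inj_eq (@lshift_inj _ _)) eq_lrshift.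
  by rewrite (inj_eq (@rshift_inj _ _)) eq_rlshift.
rewrite !big_setU1 ?in_setU1 ?mem_cols_r ?mem_cols_l ?eq_lrshift //=.
by rewrite addvA addvC addvA.
Qed.

(** As the rows of an echelon form are free, the size condition says that the selected columns are
    linearly independent. *)
Definition greedy_inv P U : Prop :=
  [/\ echelon_form setT setT U, <<map snd U>>%VS = colspan (cols P)
    & size U = (2 * #|P|)%N].

Lemma greedy_step_inv l P U P' U' :
    l \notin P -> greedy_inv P U ->
    run (greedy_step BW l (P, U)) = (P', U') ->
  greedy_inv P' U' /\ P' \subset l |: P.
Proof.
move=> lP [eU spU sU].
have z v : v \in zeros F (~: [set: 'I_w]) by rewrite setCT zeros0.
have enE : enum 'I_w = enum [set: 'I_w] by rewrite enum_setT enumT.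
rewrite /greedy_step run_bind run_bind enE.
set v1 := (col (lshift n l) BW)^T; set r1 := run (reduce _ U v1).
case p1E: (run (pivot _ r1)) => [p1|]; last first.
  by rewrite run_ret => -[<- <-]; split; rewrite // subsetUr.
have [eI spI] := span_insert eU (z v1) p1E.
rewrite run_bind run_bind; set v2 := (col (rshift n l) BW)^T.
set r2 := run (reduce _ (insert _ _ _) v2).
(* When the second remainder is zero, the row inserted for the first column is discarded too, and
   the state is the old one. *)
case p2E: (run (pivot _ r2)) => [p2|]; rewrite run_ret => -[<- <-]; last first.
  by split; rewrite // subsetUr.
have [eI2 spI2] := span_insert eI (z v2) p2E.
split=> //; split=> //; first by rewrite spI2 spI spU colspan_setU1.
have size_ins v p U0 (r := run (reduce setT U0 v)) :
    echelon_form setT setT U0 ->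
    run (pivot (enum [set: 'I_w]) r) = Some p ->
    size (insert p r U0) = (size U0).+1.
  move=> e0 pr; have [_ pI] := echelon_form_insert e0
    (reduce_zeros (echelon_form_zeros e0) (z v))
    (fun x => reduce_pivots e0 (z v) (x := x)) (pivot_notNone pr).
  by rewrite -(size_map snd) (perm_size pI) /= size_map.
by rewrite !size_ins // sU cardsU1 lP; lia.
Qed.

Lemma greedy_from_inv s P U P' U' :
    uniq s -> [disjoint s & P] -> greedy_inv P U ->
    run (greedy_from BW s (P, U)) = (P', U') ->
  greedy_inv P' U' /\ {subset P' <= [predU s & P]}.
Proof.
elim: s P U => [|l s IH] P U.
  by move=> _ _ iPU [<- <-]; split=> // i iP; rewrite inE iP orbT.
rewrite cons_uniq => /andP [ls us]; rewrite disjoint_cons => /andP [lP dsP] iPU.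
rewrite -[greedy_from _ _ _]/(bind (greedy_step BW l (P, U)) (greedy_from BW s)).
rewrite run_bind; case e: (run (greedy_step BW l (P, U))) => [P1 U1].
have [iPU1 sP1] := greedy_step_inv lP iPU e.
have dsP1 : [disjoint s & P1].
  rewrite disjoint_subset; apply/subsetP => i is_; rewrite inE.
  apply/negP => /(subsetP sP1); rewrite !inE => /predU1P [il|iP].
    by rewrite -il is_ in ls.
  by have := disjointFr dsP is_; rewrite iP.
move=> /(IH _ _ us dsP1 iPU1) [? sP']; split=> // i /sP'.
rewrite !inE => /orP [->|/(subsetP sP1)]; first by rewrite orbT.
by rewrite !inE => /predU1P [->|->]; rewrite ?eqxx ?orbT.
Qed.

Lemma selectedP s :
  uniq s ->
  exists U, greedy_inv (selected BW s) U /\ {subset selected BW s <= s}.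
Proof.
move=> us; rewrite /selected /greedy run_bind.
case e: (run (greedy_from BW s (set0, [::]))) => [P U]; rewrite run_ret; exists U.
have i0 : greedy_inv set0 [::].
  split; rewrite ?cards0 //.
  rewrite span_nil /colspan big1 // => j; rewrite inE.
  by case/orP => /imsetP [i]; rewrite inE.
have d0 : [disjoint s & (set0 : {set 'I_n})].
  by rewrite disjoint_sym disjoint_subset; apply/subsetP => i; rewrite inE.
have [? sP] := greedy_from_inv us d0 i0 e; split=> // i /sP.
by rewrite !inE orbF.
Qed.

Lemma selected_sub s : uniq s -> {subset selected BW s <= s}.
Proof. by move=> us; have [U []] := selectedP us. Qed.

(** Seen through the transpose, the selected columns span a space with a free family of [2 * #|P|]
    vectors, as many as there are columns. *)
Lemma rank_selected s (P := selected BW s) :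
  uniq s ->
  \rank (colsub (fun i : 'I_#|cols P| => enum_val i) BW) = #|cols P|.
Proof.
move=> us; have [U [[eU spU sU] _]] := selectedP us.
rewrite -mxrank_tr -dim_span_rows span_def.
rewrite big_map big_enum /=.
have -> : (\sum_(i < #|cols P|) <[row i (colsub enum_val BW)^T]>)%VS =
    colspan (cols P).
  rewrite /colspan [RHS]big_enum_val; apply: eq_bigr => i _; congr <[_]>%VS.
  by apply/rowP => j; rewrite !mxE.
by rewrite -spU (eqP (echelon_form_free eU)) size_map sU card_cols.
Qed.

End GreedyCorrect.

Section Decompose.
Variables (F : finFieldType) (n : nat) (S : {vspace 'rV[F]_(n + n)}).
Implicit Types (I K : {set 'I_n}).

Lemma shorten0_zeros K : (shorten0 K S <= zeros F (~: cols K))%VS.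
Proof. by rewrite /shorten0 supportedE colsC capvSr. Qed.

Lemma shorten0S I K : I \subset K -> (shorten0 I S <= shorten0 K S)%VS.
Proof.
move=> sIK; apply: capvS => //; apply/subvP => x.
by rewrite !mem_supported => /subset_trans ->.
Qed.

Lemma shorten0_cap K A :
  (shorten0 K S :&: zeros F (cols A))%VS = shorten0 (K :\: A) S.
Proof. by rewrite /shorten0 !supportedE setCD colsU zerosU capvA. Qed.

Lemma shorten0_disjoint I K :
  [disjoint I & K] -> (shorten0 I S :&: shorten0 K S)%VS = 0%VS.
Proof.
move=> dIK; apply/eqP; rewrite -subv0 -zerosT.
have -> : setT = ~: cols I :|: ~: cols K.
  apply/setP => j; rewrite -!colsC -colsU -setCI.
  by move: dIK; rewrite -setI_eq0 => /eqP ->; rewrite setC0 colsT.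
by rewrite zerosU; apply: capvS; apply: shorten0_zeros.
Qed.

(** Inside sigma_K, the vectors vanishing on [I] form the shortening to [K :\: I], and those
    vanishing on [K :\: I] the shortening to [I]. The remainders of [BK] that extend an echelon form
    of their sum give [BV], and freeness of the final echelon form makes the sum direct. *)
Lemma decomposeP I K BK BI BV BW :
    I \subset K -> basis_of (shorten0 K S) BK ->
    run (decompose I K BK) = (BI, BV, BW) ->
  [/\ basis_of (shorten0 I S) BI, basis_of (shorten0 (K :\: I) S) BW,
      free BV,
      (shorten0 I S + shorten0 (K :\: I) S + <<BV>>)%VS = shorten0 K S
    & directv (shorten0 I S + shorten0 (K :\: I) S + <<BV>>)].
Proof.
move=> sIK bK.
have sK : (<<BK>> <= zeros F (~: cols K))%VS.
  by rewrite (span_basis bK) shorten0_zeros.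
have fK := basis_free bK.
rewrite /decompose run_bind; case eW: (run (eliminate _ _ _ _)) => [[UW NW] BW0].
rewrite run_bind; case eI: (run (eliminate _ _ _ _)) => [[UI NI] BI0].
rewrite run_bind; case eU: (run (eliminate _ _ _ _)) => [[U NU] ZU].
rewrite run_bind; case eV: (run (eliminate _ _ _ _)) => [[UV BV0] ZV].
rewrite run_ret => -[<- <- <-] {BI BV BW}.
have := eliminate_kernel fK sK eW; rewrite (span_basis bK) shorten0_cap => bW.
have := eliminate_kernel fK sK eI; rewrite (span_basis bK) shorten0_cap.
rewrite setDDr setDv set0U (setIidPr sIK) => bI.
have sIWK : (<<BI0 ++ BW0>> <= <<BK>>)%VS.
  rewrite span_cat (span_basis bI) (span_basis bW) (span_basis bK) subv_add.
  by rewrite !shorten0S ?subsetDl.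
have [eU0 _ spU] := eliminate_complement (echelon_form_nil F _ _)
  (subv_trans sIWK sK) eU.
have [eV0 pV spV] := eliminate_complement eU0 sK eV.
have := echelon_form_free eV0; rewrite (perm_free pV) cat_free.
rewrite span_nil add0v in spU.
case/and3P => _ fBV dUV.
have spIW : <<map snd U>>%VS = (shorten0 I S + shorten0 (K :\: I) S)%VS.
  by rewrite spU span_cat (span_basis bI) (span_basis bW).
split=> //.
  rewrite -spIW -span_cat -(eq_span (perm_mem pV)) spV -(span_basis bK).
  by apply/addv_idPr; rewrite spU.
rewrite directv_addE /=; apply/and3P; split.
  apply/directv_addP; apply: shorten0_disjoint.
  by rewrite disjoints_subset; apply/subsetP => i iI; rewrite !inE iI.
  by rewrite directv_trivial.
by rewrite -spIW; apply/eqP/directv_addP.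
Qed.

End Decompose.

(** * The reduction procedure *)

Section Reduction.
Variables (F : finFieldType) (n : nat).
Implicit Types (I K P : {set 'I_n}) (s : seq 'I_n) (BK : seq 'rV[F]_(n + n)).

(** The bound [4 * k] leaves room for two concatenated bases of at most [2 * k] vectors. The product
    expands to at most [128 * k ^ 3 + 40 * k ^ 2], and [k ^ 2 <= k ^ 3] gives 168. *)
Lemma eliminate_cubic K (J : {set 'I_n}) U (B : seq 'rV[F]_(n + n)) k :
    #|K| = k -> J \subset K -> (size U <= 4 * k)%N -> (size B <= 4 * k)%N ->
  (steps (eliminate (cols K) (cols J) U B) <= 168 * k ^ 3)%N.
Proof.
move=> Kk /subset_leq_card; rewrite Kk => Jk Uk Bk.
have [_ _] := eliminate_size_steps (cols K) (cols J) U B.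
rewrite !card_cols Kk => /leq_trans -> //.
have h : ((size U + size B) * (1 + 2 * (2 * k)) + 2 * #|J| <=
    (8 * k) * (1 + 4 * k) + 2 * k)%N.
  by apply: leq_add; [apply: leq_mul; lia|lia].
apply: leq_trans (leq_mul Bk h) _.
by have : (k ^ 2 <= k ^ 3)%N; rewrite !expnS expn0 ?muln1; nia.
Qed.

(** Four eliminations at [168 * k ^ 3] each. *)
Lemma decompose_size_steps I K BK k :
    #|K| = k -> I \subset K -> (size BK <= 2 * k)%N ->
  let t := decompose I K BK in
  [/\ (size (run t).1.1 <= 2 * k)%N, (size (run t).1.2 <= 2 * k)%N,
      (size (run t).2 <= 2 * k)%N & (steps t <= 672 * k ^ 3)%N].
Proof.
move=> Kk sIK BKk; rewrite /decompose !run_bind !steps_bind.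
have B4 : (size BK <= 4 * k)%N by lia.
have [_ sW _] := eliminate_size_steps (cols K) (cols I) [::] BK.
have tW := eliminate_cubic Kk sIK (U := [::]) (leq0n _) B4.
case: (run _) sW => [[UW NW] BW] /= sW; rewrite !run_bind !steps_bind.
have [_ sI _] := eliminate_size_steps (cols K) (cols (K :\: I)) [::] BK.
have tI := eliminate_cubic Kk (subsetDl K I) (U := [::]) (leq0n _) B4.
case: (run _) sI => [[UI NI] BI] /= sI; rewrite !run_bind !steps_bind.
have IW4 : (size (BI ++ BW) <= 4 * k)%N by rewrite size_cat; lia.
have [sU _ _] := eliminate_size_steps (cols K) (cols K) [::] (BI ++ BW).
have tU := eliminate_cubic Kk (subxx K) (U := [::]) (leq0n _) IW4.
case: (run _) sU => [[U NU] ZU] /= sU; rewrite !run_bind !steps_bind.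
have U4 := leq_trans sU IW4.
have [_ sV _] := eliminate_size_steps (cols K) (cols K) U BK.
have tV := eliminate_cubic Kk (subxx K) U4 B4.
case: (run _) sV => [[UV BV] ZV] /= sV; rewrite steps_ret.
by split; lia.
Qed.

(** The product of the bounds is [16 * k ^ 3 + 8 * k ^ 2]. *)
Lemma steps_greedy w (BW : 'M[F]_(w, n + n)) s k :
  (size s <= k)%N -> (w <= 2 * k)%N -> (steps (greedy BW s) <= 24 * k ^ 3)%N.
Proof.
move=> sk wk; rewrite /greedy steps_bind.
have st := steps_greedy_from BW s set0 [::].
case: (run _) => P U; rewrite steps_ret addn0; apply: leq_trans st _.
have h : ((0 + 2 * size s) * (1 + 2 * w) + w <= 2 * k * (1 + 4 * k) + 2 * k)%N.
  by apply: leq_add => //; apply: leq_mul; lia.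
apply: leq_trans (leq_mul sk (leq_mul (leqnn 2) h)) _.
by have : (k ^ 2 <= k ^ 3)%N; rewrite !expnS expn0 ?muln1; nia.
Qed.

Lemma steps_reduction I K s BK :
    I \subset K -> perm_eq s (enum (K :\: I)) -> (size BK <= 2 * #|K|)%N ->
  (steps (reduction I K s BK) <= 888 * #|K| ^ 3)%N.
Proof.
set k := #|K|; have Kk : #|K| = k by [].
move=> sIK ps BKk; rewrite /reduction steps_bind.
have us : uniq s by rewrite (perm_uniq ps) enum_uniq.
have sk : (size s <= k)%N.
  by rewrite (perm_size ps) -cardE subset_leq_card // subsetDl.
have [] := decompose_size_steps Kk sIK BKk.
case: (run _) => [[BI BV] BW] /= _ sBV sBW tD.
rewrite steps_bind -/(selected (mxrows BW) s).
have tG := steps_greedy (mxrows BW) sk sBW.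
have sPK : selected (mxrows BW) s \subset K.
  apply/subsetP => i /(selected_sub us).
  by rewrite (perm_mem ps) mem_enum inE => /andP [].
have BW4 : (size BW <= 4 * k)%N by lia.
have [sU _ _] := eliminate_size_steps (cols K) (cols (selected (mxrows BW) s))
  [::] BW.
have tU := eliminate_cubic Kk sPK (U := [::]) (leq0n _) BW4.
rewrite steps_bind.
case: (run _) sU => [[U N] Z] /= sU; rewrite !steps_bind steps_ret.
have tR : (steps (reduce_all (cols K) U BV) <= 20 * k ^ 3)%N.
  rewrite steps_reduce_all card_cols Kk.
  have h : (size U * (1 + 2 * (2 * k)) <= 2 * k * (1 + 4 * k))%N.
    by apply: leq_mul; lia.
  apply: leq_trans (leq_mul sBV h) _.
  by have : (k ^ 2 <= k ^ 3)%N; rewrite !expnS expn0 ?muln1; nia.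
have tS : (steps (supps (enum K) (run (reduce_all (cols K) U BV)))
    <= 4 * k ^ 3)%N.
  rewrite steps_supps run_reduce_all size_map -cardE Kk.
  apply: leq_trans (leq_mul sBV (leqnn _)) _.
  by rewrite !expnS expn0 muln1; nia.
(* The sum is 672 + 24 + 168 + 20 + 4 = 888, for decomposition, greedy selection, elimination,
   reduction of [BV] and supports. *)
apply: leq_trans (leq_add tD (leq_add tG (leq_add tU
  (leq_add tR (leq_add tS (leqnn 0)))))) _.
by lia.
Qed.

Lemma run_suppc s (u : 'rV[F]_(n + n)) :
  run (suppc s u) = [set i in s | i \in supp u].
Proof.
have memE t i : (i \in [set j in t | j \in supp u]) = (i \in t) && (i \in supp u).
  by rewrite in_set.
elim: s => [|l s IH]; first by apply/setP => i; rewrite memE inE.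
rewrite [suppc _ _]/= !run_bind IH run_ret; apply/setP => i.
rewrite -[_ && _](notin_supp u l) memE in_cons.
case: ifPn => [lu|/negPn lu]; rewrite ?in_setU1 memE.
  by case: eqVneq => // ->; rewrite (negPf lu) !andbF.
by case: eqVneq => // ->; rewrite lu.
Qed.

Lemma run_supps s (B : seq 'rV[F]_(n + n)) :
    (forall u, u \in B -> supp u \subset s) ->
  run (supps s B) = \bigcup_(u <- B) supp u.
Proof.
elim: B => [|u B IH] sB; first by rewrite big_nil.
rewrite [supps _ _]/= !run_bind run_ret IH => [|v vB]; last first.
  by apply: sB; rewrite inE vB orbT.
rewrite big_cons run_suppc; congr (_ :|: _); apply/setP => i; rewrite in_set.
by apply: andb_idl; apply: (subsetP (sB u (mem_head _ _))).
Qed.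

(** Ties the program to the procedure: its output arises from a legal sequence of choices, with [V]
    the span of the computed [BV]. *)
Lemma reductionP (S : {vspace 'rV[F]_(n + n)}) I K s BK BI BVt J :
    I \subset K -> basis_of (shorten0 K S) BK -> perm_eq s (enum (K :\: I)) ->
    run (reduction I K s BK) = (BI, BVt, J) ->
  exists rV rW V (BV : 'M[F]_(rV, n + n)) (BW : 'M[F]_(rW, n + n)) M,
    [/\ reduction_choices S I K V (mxrows BI) BV BW s M,
        BVt = rows (BV - M *m BW)
      & J = recovery_set I (BV - M *m BW)].
Proof.
move=> sIK bK ps; rewrite /reduction run_bind.
case eD: (run (decompose _ _ _)) => [[BI0 BV] BW].
have [bI bW fV sumV dirV] := decomposeP sIK bK eD.
rewrite run_bind -/(selected (mxrows BW) s); set P := selected _ _.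
rewrite run_bind; case eU: (run (eliminate _ _ _ _)) => [[U N] Z].
rewrite !run_bind run_ret run_reduce_all => -[<-].
have us : uniq s by rewrite (perm_uniq ps) enum_uniq.
have sPK : P \subset K.
  apply/subsetP => i /(selected_sub us).
  by rewrite (perm_mem ps) mem_enum inE => /andP [].
have sW : (<<BW>> <= zeros F (~: cols K))%VS.
  rewrite (span_basis bW) (subv_trans (shorten0_zeros _ _)) //.
  rewrite -!colsC; apply/subvP => x; rewrite !zeros_colsE !setCK.
  by move=> /subset_trans ->; rewrite ?subsetDl.
have [[eU0 pU _] _ /= spU] := eliminate_spec (echelon_form_nil F _ _) sW eU.
have sUW : (<<map snd U>> <= <<BW>>)%VS.
  by rewrite (eq_span (perm_mem pU)) /= -spU span_cat addvSl.
have sV : (<<BV>> <= zeros F (~: cols K))%VS.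
  by apply: subv_trans _ (shorten0_zeros S K); rewrite -sumV addvSr.
have V0 v : v \in BV -> v \in zeros F (~: cols K).
  by move=> vV; apply: subvP sV _ (memv_span vV).
(* The selected columns of [BW] are independent, so each of them carries a pivot and gets cleared in
   every remainder. *)
have pivP := eliminate_pivots sW (rank_selected _ us) eU.
set R := [seq run _ | v <- BV] => eR eJ.
have szR : size BV = size R by rewrite size_map.
pose Bt : 'M[F]_(size BV, n + n) := \matrix_i R`_i.
have BtR : rows Bt = R.
  apply: (@eq_from_nth _ 0) => [|i]; rewrite size_rows // => iV.
  by rewrite (nth_rows Bt (Ordinal iV)) rowK.
(* The program never forms [M]. Each remainder differs from its row of [BV] by an element of the
   span of [BW], and the coefficients of these differences make up [M]. *)
have /submxP [M BtE] : (mxrows BV - Bt <= mxrows BW)%MS.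
  apply/row_subP => i; rewrite -mem_span_rows mxrowsK; apply: subvP sUW _ _.
  have -> : row i (mxrows BV - Bt) = BV`_i - run (reduce (cols K) U BV`_i).
    rewrite linearB /= !rowK; congr (_ - _).
    by rewrite (nth_map 0) //; apply: ltn_ord.
  apply: reduce_sub_span (echelon_form_zeros eU0) (V0 _ _).
  by apply: mem_nth.
have BtM : Bt = mxrows BV - M *m mxrows BW by rewrite -BtE opprB addrC subrK.
exists (size BV), (size BW), <<BV>>%VS, (mxrows BV), (mxrows BW), M.
rewrite -BtM /recovery_set BtR; split=> //; last first.
  rewrite -eJ run_supps // => u /mapP [v vV ->].
  apply/subsetP => i iu; rewrite mem_enum; move: i iu; apply/subsetP.
  have := reduce_zeros (echelon_form_zeros eU0) (V0 v vV).
  by rewrite -colsC zeros_colsE setCK.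
split; rewrite ?mxrowsK -?sumV //; first by rewrite /basis_of eqxx.
split=> // j jP; rewrite -BtM; apply/colP => i; rewrite !mxE.
have [x xU <-] := pivP j jP.
rewrite (nth_map 0); last exact: ltn_ord.
by apply: reduce_pivots eU0 (V0 _ _) xU; apply: mem_nth.
Qed.

End Reduction.

(** * Symplectic form and glued vectors *)

Section SymplecticForm.
Variables (F : finFieldType) (m : nat).
Implicit Types (x y : 'rV[F]_(m + m)) (S : {vspace 'rV[F]_(m + m)}).

Lemma sympC x y : symp x y = - symp y x.
Proof.
by rewrite -sumrN; apply: eq_bigr => i _; rewrite opprB ![y 0 _ * _]mulrC.
Qed.

Lemma symp_linear x a y z : symp x (a *: y + z) = a * symp x y + symp x z.
Proof.
rewrite mulr_sumr -big_split; apply: eq_bigr => i _ /=.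
by rewrite !mxE mulrBr !mulrDr !(mulrCA _ a) opprD addrACA.
Qed.

Lemma symp0 x : symp x 0 = 0.
Proof. by rewrite /symp big1 // => i _; rewrite !mxE !mulr0 subr0. Qed.

Lemma symp_span x (X : seq 'rV[F]_(m + m)) y :
  (forall z, z \in X -> symp x z = 0) -> y \in <<X>>%VS -> symp x y = 0.
Proof.
move=> X0 /(coord_span (X := in_tuple X)) ->.
elim/big_ind: _ => [|u v u0 v0|i _]; first exact: symp0.
  by rewrite -[u]scale1r symp_linear u0 v0 mulr0 addr0.
by rewrite -[_ *: _]addr0 symp_linear symp0 X0 ?mulr0 ?addr0 // mem_nth.
Qed.

Lemma eq_symp x y z (I : {set 'I_m}) :
  supp x \subset I -> y - z \in zeros F (cols I) -> symp x y = symp x z.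
Proof.
move=> /subsetP xI /zerosP yz; apply: eq_bigr => i _.
have [iI|iI] := boolP (i \in I).
  have e j : j \in cols I -> y 0 j = z 0 j.
    by move=> /yz; rewrite !mxE => /eqP; rewrite subr_eq0 => /eqP.
  by rewrite !e ?mem_cols_l ?mem_cols_r.
have /contra /(_ iI) := xI i; rewrite notin_supp => /andP [/eqP -> /eqP ->].
by rewrite !mul0r.
Qed.

Lemma symp_delta_r x i : symp x (delta_mx 0 (rshift m i)) = x 0 (lshift m i).
Proof.
rewrite /symp (bigD1 i) //= !mxE !eqxx eq_lrshift mulr1 mulr0 subr0.
rewrite big1 ?addr0 // => j ji.
by rewrite !mxE eq_lrshift (inj_eq (@rshift_inj _ _)) (negPf ji) !mulr0 subr0.
Qed.

Lemma symp_delta_l x i : symp x (delta_mx 0 (lshift m i)) = - x 0 (rshift m i).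
Proof.
rewrite /symp (bigD1 i) //= !mxE !eqxx eq_rlshift mulr1 mulr0 sub0r.
rewrite big1 ?addr0 // => j ji.
by rewrite !mxE eq_rlshift (inj_eq (@lshift_inj _ _)) (negPf ji) !mulr0 subr0.
Qed.

(** Pairing with the unit vectors reads off every coordinate up to sign. *)
Lemma symp_nondegenerate x : (forall y, symp x y = 0) -> x = 0.
Proof.
move=> x0; apply/rowP => j; rewrite mxE; case: (split_ordP j) => i ->.
  by rewrite -symp_delta_r.
by apply/eqP; rewrite -oppr_eq0 -symp_delta_l x0.
Qed.

(** Restriction to [I] as an endomorphism: it has the same kernel as puncturing, hence the same rank
    on every subspace, and avoids reindexing. *)
Definition cols_mask (I : {set 'I_m}) : 'M[F]_(m + m) :=
  diag_mx (\row_j (j \in cols I)%:R).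

Lemma mulmx_mask I x : x *m cols_mask I = \row_j (x 0 j * (j \in cols I)%:R).
Proof.
apply/rowP => j; rewrite !mxE (bigD1 j) //= !mxE eqxx mulr1n big1 ?addr0 //.
by move=> i ij; rewrite !mxE (negPf ij) mulr0n mulr0.
Qed.

Lemma lker_mask I : lker (linfun (mulmxr (cols_mask I)) : 'Hom('rV[F]_(m + m), _)) =
  zeros F (cols I).
Proof.
apply/vspaceP => x; rewrite memv_ker lfunE /= mulmx_mask.
apply/eqP/zerosP => [x0 j jI|x0].
  by move/rowP/(_ j): x0; rewrite !mxE jI mulr1.
apply/rowP => j; rewrite !mxE.
by case: (boolP (j \in _)) => [/x0 ->|_]; rewrite ?mul0r ?mulr0.
Qed.

(** Turns a functional that depends only on the coordinates in [I] into an error supported in [I];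
    used to make errors out of cokernel vectors. *)
Lemma symp_represents (I : {set 'I_m}) (v : 'cV[F]_(m + m)) :
  exists2 x, supp x \subset I & forall y, symp x y = (y *m cols_mask I *m v) 0 0.
Proof.
(* The halves of [v] are swapped and the second one gets a sign, which undoes the twist of the
   form. *)
exists (row_mx (\row_i (v (rshift m i) 0 * (i \in I)%:R))
               (\row_i (- (v (lshift m i) 0 * (i \in I)%:R)))).
  apply/subsetP => i; apply: contraLR => iI; rewrite notin_supp.
  by rewrite row_mxEl row_mxEr !mxE (negPf iI) !mulr0 oppr0 eqxx.
move=> y; rewrite mulmx_mask !mxE big_split_ord /= -big_split /=.
apply: eq_bigr => i _; rewrite row_mxEl row_mxEr !mxE mem_cols_l mem_cols_r.
by ring.
Qed.

Lemma lker_puncture (I : {set 'I_m}) :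
  lker (linfun (colsub (pair_index (fun i : 'I_#|I| => enum_val i)))
    : 'Hom('rV[F]_(m + m), _)) = zeros F (cols I).
Proof.
apply/vspaceP => x; rewrite [LHS]memv_ker lfunE /=.
apply/eqP/zerosP => [/rowP x0 j|x0]; last first.
  apply/rowP => j; rewrite !mxE x0 // /pair_index.
  by case: (split j) => i; rewrite ?mem_cols_l ?mem_cols_r enum_valP.
case: (split_ordP j) => i ->; rewrite ?mem_cols_l ?mem_cols_r => iI.
  have := x0 (lshift _ (enum_rank_in iI i)); rewrite !mxE /pair_index.
  by rewrite (unsplitK (inl _)) enum_rankK_in.
have := x0 (rshift _ (enum_rank_in iI i)); rewrite !mxE /pair_index.
by rewrite (unsplitK (inr _)) enum_rankK_in.
Qed.

Lemma dim_puncture_set (I : {set 'I_m}) S :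
  (\dim (S :&: zeros F (cols I)) + \dim (puncture_set I S))%N = \dim S.
Proof. by rewrite -lker_puncture limg_ker_dim. Qed.

Lemma puncture_set_lift (I : {set 'I_m}) S S' x :
    puncture_set I S = puncture_set I S' -> x \in S ->
  exists2 y, y \in S' & x - y \in zeros F (cols I).
Proof.
move=> eSS' xS; set f : 'Hom('rV[F]_(m + m), 'rV[F]_(#|I| + #|I|)) :=
  linfun (colsub (pair_index (fun i : 'I_#|I| => enum_val i))).
have : f x \in puncture_set I S' by rewrite -eSS' memv_img.
case/memv_imgP => y yS' fxy; exists y => //.
by rewrite -lker_puncture memv_ker linearB /= fxy subrr.
Qed.

End SymplecticForm.

Section Glue.
Variables (F : finFieldType) (n c : nat).
Implicit Types (x : 'rV[F]_(n + n)) (y : 'rV[F]_(c + c)).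
Implicit Types v : 'rV[F]_((n + c) + (n + c)).

Definition gluel v : 'rV[F]_(n + n) :=
  row_mx (lsubmx (lsubmx v)) (lsubmx (rsubmx v)).

Definition gluer v : 'rV[F]_(c + c) :=
  row_mx (rsubmx (lsubmx v)) (rsubmx (rsubmx v)).

Lemma gluelK x y : gluel (glue x y) = x.
Proof. by rewrite /gluel /glue !(row_mxKl, row_mxKr) hsubmxK. Qed.

Lemma glueK v : glue (gluel v) (gluer v) = v.
Proof. by rewrite /gluel /gluer /glue !(row_mxKl, row_mxKr) !hsubmxK. Qed.

Lemma symp_glue x y x' y' :
  symp (glue x y) (glue x' y') = symp x x' + symp y y'.
Proof.
rewrite [LHS]big_split_ord /=; congr (_ + _); apply: eq_bigr => i _;
by rewrite !(row_mxEl, row_mxEr) !mxE.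
Qed.

Lemma supp_glue x y i : (lshift c i \in supp (glue x y)) = (i \in supp x).
Proof. by rewrite !inE !(row_mxEl, row_mxEr) !mxE. Qed.

Lemma supp_codeword_qudits v (I : {set 'I_n}) :
    supp v \subset [set lshift c i | i in I] ->
  v = glue (gluel v) 0 /\ supp (gluel v) \subset I.
Proof.
move=> /subsetP vI; split.
  rewrite -{1}(glueK v); congr glue; apply/rowP => j; rewrite mxE.
  have r0 i : rshift n i \notin supp v.
    by apply/negP => /vI /imsetP [k _ /eqP]; rewrite eq_rlshift.
  case: (split_ordP j) => i ->; have := r0 i; rewrite notin_supp;
    by rewrite ?row_mxEl ?row_mxEr !mxE => /andP [/eqP ? /eqP ?].
apply/subsetP => i; rewrite -(supp_glue _ (gluer v)) glueK => /vI.
by move=> /imsetP [k kI /eqP]; rewrite (inj_eq (@lshift_inj _ _)) => /eqP ->.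
Qed.

End Glue.

(** * Sufficient sets of observables *)

Section Observables.
Variables (F : finFieldType) (n c : nat).
Variables (C : {vspace 'rV[F]_(n + n)}) (C' : {vspace 'rV[F]_((n + c) + (n + c))}).
Variable alpha : 'rV[F]_(n + n) -> 'rV[F]_(c + c).
Let D := symp_orth C.
Let D' := symp_orth C'.
Let beta x := glue x (alpha x).
Hypothesis D'C' : (D' <= C')%VS.
Hypothesis alpha_surj : forall y, exists2 x, x \in D & alpha x = y.
Hypothesis D'E : forall v, v \in D' <-> exists2 x, x \in D & v = beta x.

Lemma beta_mem x : x \in D -> beta x \in D'.
Proof. by move=> xD; apply/D'E; exists x. Qed.

Lemma stabilizer_isotropic u v : u \in D' -> v \in D' -> symp u v = 0.
Proof.
rewrite mem_symp_orth => /forall_inP u0 vD'.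
exact/eqP/u0/(subvP D'C').
Qed.

Lemma symp_beta e u : symp (glue e 0) (beta u) = symp e u.
Proof. by rewrite symp_glue (sympC 0) symp0 oppr0 addr0. Qed.

(* If e is also orthogonal to D, then isotropy of D' gives
   <alpha e, alpha x> = 0 for all x in D, whence alpha e = 0. *)
Lemma glue0_stabilizer e :
  e \in D -> (forall x, x \in D -> symp e x = 0) -> glue e 0 \in D'.
Proof.
move=> eD eD0; suff a0 : alpha e = 0 by rewrite -a0; apply: beta_mem.
apply: symp_nondegenerate => y; have [x xD <-] := alpha_surj y.
have := stabilizer_isotropic (beta_mem eD) (beta_mem xD).
by rewrite symp_glue eD0 // add0r.
Qed.

(** The span of [X] need reach sigma_K only modulo vectors vanishing on [I], which errors in [I]
    cannot see. This is what allows [B_W] to be left out of the observables. *)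
Lemma repair_sufficient I K (X : seq 'rV[F]_(n + n)) :
    repair_group C I K -> {subset X <= D} ->
    (shorten0 K D <= <<X>> + zeros F (cols I))%VS ->
  sufficient_observables C' I [set beta u | u in X].
Proof.
move=> rep XD sKX; split=> [_ /imsetP [u /XD uD ->]|e eI e0].
  exact: beta_mem.
have [eE suppe] := supp_codeword_qudits eI.
have X0 u : u \in X -> symp (gluel e) u = 0.
  by move=> uX; rewrite -symp_beta -eE e0 // imset_f.
have K0 z : z \in shorten0 K D -> symp (gluel e) z = 0.
  move=> /(subvP sKX) /memv_addP [a aX [b bI ->]].
  rewrite (eq_symp suppe (z := a)); first exact: symp_span X0 aX.
  by rewrite addrAC subrr add0r.
have CD0 z : z \in (C + D)%VS -> symp (gluel e) z = 0.
  move=> /(puncture_set_lift rep) [y /K0 <-]; exact: eq_symp.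
rewrite eE; apply: glue0_stabilizer => [|x xD].
  rewrite mem_symp_orth; apply/forall_inP => x xC; apply/eqP/CD0.
  exact: subvP (addvSl _ _) _ xC.
exact/CD0/(subvP (addvSr _ _)).
Qed.

(** If qudit [i] were not measured, both unit errors at [i] would go undetected and lie in the
    stabilizer; but their pairing is 1, against isotropy. *)
Lemma sufficient_supp I (T : {set 'rV[F]_((n + c) + (n + c))}) i :
    sufficient_observables C' I T -> i \in I ->
  lshift c i \in \bigcup_(v in T) supp v.
Proof.
move=> [TD' Tsuff] iI; apply: contraT => iT.
have out v : v \in T ->
    v 0 (lshift _ (lshift c i)) = 0 /\ v 0 (rshift _ (lshift c i)) = 0.
  move=> vT; have : lshift c i \notin supp v.
    by apply: contra iT => iv; apply/bigcupP; exists v.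
  by rewrite notin_supp => /andP [/eqP -> /eqP ->].
have supp_delta j :
    (j == lshift _ (lshift c i)) || (j == rshift _ (lshift c i)) ->
    supp (delta_mx 0 j : 'rV[F]_((n + c) + (n + c)))
      \subset [set lshift c i | i in I].
  move=> ji; apply/subsetP => k; case: (eqVneq k (lshift c i)) => [-> _|ki].
    exact: imset_f.
  apply: contraLR => _; rewrite notin_supp !mxE eqxx /=.
  by case/orP: ji => /eqP ->; rewrite ?eq_lrshift ?eq_rlshift
    ?(inj_eq (@lshift_inj _ _)) ?(inj_eq (@rshift_inj _ _)) (negPf ki) eqxx.
have rD' : delta_mx 0 (rshift _ (lshift c i)) \in D'.
  apply: Tsuff => [|v /out [v0 _]]; first by apply: supp_delta; rewrite eqxx orbT.
  by rewrite sympC symp_delta_r v0 oppr0.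
have lD' : delta_mx 0 (lshift _ (lshift c i)) \in D'.
  apply: Tsuff => [|v /out [_ v0]]; first by apply: supp_delta; rewrite eqxx.
  by rewrite sympC symp_delta_l v0 !oppr0.
have /eqP := stabilizer_isotropic lD' rD'.
by rewrite symp_delta_r mxE !eqxx oner_eq0.
Qed.

(** [A] and [B] hold the restrictions to [I] of [T] and of a basis of [D]. Once the row space of [B]
    lies in that of [A], the rank of [B] is at most the number of rows of [A]. *)
Lemma sufficient_card I (T : {set 'rV[F]_((n + c) + (n + c))}) :
  sufficient_observables C' I T -> (\dim (puncture_set I D) <= #|T|)%N.
Proof.
move=> [TD' Tsuff].
pose A := mxrows [seq gluel v | v <- enum T] *m cols_mask F I.
pose B := mxrows (vbasis D) *m cols_mask F I.
have TE v : v \in T -> exists2 u, v = beta u & gluel v = u.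
  by move=> /TD' /D'E [u _ ->]; exists u; rewrite // gluelK.
(* Row space inclusion is tested on the columns [v] of the cokernel of [A]. Such a [v] corresponds
   to an error [e] in [I] undetected by [T], hence in the stabilizer and orthogonal to [D]; so [B]
   kills [v] too. *)
have sBA : (B <= A)%MS.
  rewrite submxE; apply/eqP/matrixP => i j; rewrite [RHS]mxE.
  set v := col j (cokermx A).
  have Av : A *m v = 0 by rewrite /v colE mulmxA mulmx_coker mul0mx.
  have [e suppe eE] := symp_represents I v.
  have eT t : t \in T -> symp (glue e 0) t = 0.
    move=> tT; have [u tu tE] := TE t tT; rewrite tu symp_beta eE -tE.
    have tX : gluel t \in [seq gluel v | v <- enum T].
      by apply/mapP; exists t; rewrite ?mem_enum.
    have := tX; rewrite -[X in _ \in X]mxrowsK => /mapP [k _ ->].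
    by rewrite -!row_mul -/A Av !mxE.
  have eD' : glue e 0 \in D'.
    apply: Tsuff eT; apply/subsetP => k.
    case: (split_ordP k) => l ->.
      by rewrite supp_glue => /(subsetP suppe) /imset_f.
    by rewrite inE !(row_mxEl, row_mxEr) !mxE eqxx.
  have bD : row i (mxrows (vbasis D)) \in D.
    by apply: vbasis_mem; rewrite rowK mem_nth.
  have := stabilizer_isotropic eD' (beta_mem bD); rewrite symp_beta eE.
  by rewrite -!row_mul -/B /v colE mulmxA -colE mxE mxE.
have rkB : \rank B = \dim (puncture_set I D).
  rewrite -dim_span_rows.
  have -> : rows B =
      map (linfun (mulmxr (cols_mask F I))) (rows (mxrows (vbasis D))).
    by rewrite -map_comp; apply: eq_map => i /=; rewrite lfunE /= row_mul.
  rewrite -limg_span mxrowsK (span_basis (vbasisP D)).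
  (* Masking and puncturing have the same kernel on [D], so rank-nullity gives images of equal
     dimension. *)
  apply: (@addnI (\dim (D :&: zeros F (cols I)))).
  by rewrite dim_puncture_set -(lker_mask F I) limg_ker_dim.
rewrite -rkB (leq_trans (mxrankS sBA)) // (leq_trans (rank_leq_row _)) //.
by rewrite size_map cardE.
Qed.

End Observables.

(** * Properties of every legal run of the reduction *)

Section Choices.
Variables (F : finFieldType) (n : nat) (S : {vspace 'rV[F]_(n + n)}).
Variables (I K : {set 'I_n}) (rI rV rW : nat) (V : {vspace 'rV[F]_(n + n)}).
Variables (BI : 'M[F]_(rI, n + n)) (BV : 'M[F]_(rV, n + n)).
Variables (BW : 'M[F]_(rW, n + n)) (s : seq 'I_n) (M : 'M[F]_(rV, rW)).
Hypothesis sIK : I \subset K.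
Hypothesis choices : reduction_choices S I K V BI BV BW s M.
Let BVt := BV - M *m BW.

Lemma basis_rows_dim r (B : 'M[F]_(r, n + n)) U :
  basis_of U (rows B) -> \dim U = r.
Proof.
move=> bU; have /eqP := basis_free bU.
by rewrite (span_basis bU) size_rows.
Qed.

(** Modulo the span of [BW], the rows of [BVt] and of [BV] agree. *)
Lemma reduced_span :
  (shorten0 I S + <<rows BVt>> + shorten0 (K :\: I) S)%VS = shorten0 K S.
Proof.
have [[-> _] _ bV bW _] := choices.
rewrite -!addvA [(<<rows BVt>> + _)%VS]addvC; congr (_ + _)%VS.
rewrite -(span_basis bV) -(span_basis bW).
have MW i : row i (M *m BW) \in <<rows BW>>%VS.
  by rewrite mem_span_rows row_mul submxMl.
have half r (X Y : 'M[F]_(r, n + n)) :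
    (forall i, row i X - row i Y \in <<rows BW>>%VS) ->
    (<<rows BW>> + <<rows X>> <= <<rows BW>> + <<rows Y>>)%VS.
  move=> XY; rewrite subv_add addvSl; apply/span_subvP => _ /mapP [i _ ->].
  by rewrite -[row i X](subrK (row i Y)) memv_add // memv_span ?mem_rows.
apply: subv_anti; rewrite !half // => i; rewrite linearB /=.
  by rewrite opprB addrC subrK.
by rewrite addrAC subrr add0r rpredN.
Qed.

Lemma reduced_dim : \dim (shorten0 K S) = (rI + rV + \dim (shorten0 (K :\: I) S))%N.
Proof.
have [[-> dirV] bI bV _ _] := choices; move: dirV; rewrite directvE /= => /eqP ->.
by rewrite (basis_rows_dim bI) (basis_rows_dim bV) addnAC.
Qed.

(** Freeness by counting: these [rI + rV] vectors together with the shortening to [K :\: I] span a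
    space of dimension [rI + rV] plus that of this shortening, so their span cannot have smaller
    dimension. *)
Lemma reduced_basis :
  directv (shorten0 I S + <<rows BVt>>) /\
  basis_of (shorten0 I S + <<rows BVt>>) (rows BI ++ rows BVt).
Proof.
have [_ bI _ _ _] := choices.
have sp : <<rows BI ++ rows BVt>>%VS = (shorten0 I S + <<rows BVt>>)%VS.
  by rewrite span_cat (span_basis bI).
have fr : free (rows BI ++ rows BVt).
  rewrite /free eqn_leq dim_span sp size_cat !size_rows.
  have := reduced_dim; rewrite -reduced_span => dimE.
  have := dimv_add_leqif (shorten0 I S + <<rows BVt>>)%VS (shorten0 (K :\: I) S).
  by rewrite dimE => -[]; rewrite leq_add2r.
split; last by rewrite /basis_of sp eqxx.
by move: fr; rewrite cat_free => /and3P [_ _]; rewrite (span_basis bI).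
Qed.

Lemma reduced_supp u : u \in rows BI ++ rows BVt ->
  (supp u \subset K) /\ (u \in S).
Proof.
move=> uB; have [_ bI _ _ _] := choices.
have uK : u \in shorten0 K S.
  rewrite -reduced_span; apply: subvP (addvSl _ _) _ _.
  by rewrite -(span_basis reduced_basis.2) memv_span.
by move: uK; rewrite memv_cap mem_supported => /andP [].
Qed.

Lemma selected_subset : selected BW s \subset K :\: I.
Proof.
have [_ _ _ _ [ps _]] := choices.
apply/subsetP => i; have us : uniq s by rewrite (perm_uniq ps) enum_uniq.
by move=> /(selected_sub us); rewrite (perm_mem ps) mem_enum.
Qed.

Lemma mem_recovery_set i :
  (i \in recovery_set I BVt) = (i \in I) || [exists u in rows BVt, i \in supp u].
Proof.
rewrite in_setU bigcup_seq; congr (_ || _).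
by apply/bigcupP/exists_inP.
Qed.

(** The elimination step clears the columns of the selected qudits, and these avoid [I]. *)
Lemma recovery_set_subset : recovery_set I BVt \subset K :\: selected BW s.
Proof.
apply/subsetP => i; rewrite mem_recovery_set in_setD.
case/orP => [iI|/exists_inP [u uB iu]].
  rewrite (subsetP sIK) // andbT.
  by apply/negP => /(subsetP selected_subset); rewrite in_setD iI.
have [|/subsetP suK _] := reduced_supp (u := u).
  by rewrite mem_cat uB orbT.
rewrite suK // andbT; apply: contraL iu => iP; rewrite notin_supp.
have [_ _ _ _ [_ selP]] := choices; case/mapP: uB => r _ ->.
have z j : j \in cols (selected BW s) -> row r BVt 0 j = 0.
  by move=> /selP /colP /(_ r); rewrite !mxE.
by rewrite !z ?eqxx ?mem_cols_l ?mem_cols_r.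
Qed.

End Choices.

(** The constant is chosen before the field, the code and the sets, so the cubic bound is uniform.
    The other claims are proved for every legal sequence of choices, and the program is shown to
    follow one. *)
Theorem theorem3p1 :
  exists A : nat,
  forall (F : finFieldType) (p n c : nat)
    (C : {vspace 'rV[F]_(n + n)})
    (C' : {vspace 'rV[F]_((n + c) + (n + c))})
    (alpha : 'rV[F]_(n + n) -> 'rV[F]_(c + c))
    (I K : {set 'I_n}),
  let D := symp_orth C in
  let D' := symp_orth C' in
  let beta x := glue x (alpha x) in
  p \in [pchar F] ->
  (2 <= n)%N ->
  C != fullv ->
  (C :&: D)%VS != C ->
  (2 * c)%N = (\dim D - \dim (C :&: D))%N ->
  (0 < 2 * c)%N ->
  \dim C' = (\dim C + 2 * c)%N ->
  shortened (lshift c) C' = C ->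
  puncture (lshift c) D' = D ->
  (D' <= C')%VS ->
  (forall (a : 'F_p) x y, x \in D -> y \in D ->
     alpha ((a : nat)%:R *: x + y) = (a : nat)%:R *: alpha x + alpha y) ->
  (forall y, exists2 x, x \in D & alpha x = y) ->
  (forall v, v \in D' <-> exists2 x, x \in D & v = beta x) ->
  I != set0 ->
  I \proper K ->
  repair_group C I K ->
  (forall r (BK : 'M[F]_(r, n + n)) s,
     basis_of (shorten0 K D) (rows BK) ->
     perm_eq s (enum (K :\: I)) ->
     let: (BI, BVt, J) := run (reduction I K s (rows BK)) in
     (steps (reduction I K s (rows BK)) <= A * #|K| ^ 3)%N /\
     (exists rV rW V (BV : 'M[F]_(rV, n + n)) (BW : 'M[F]_(rW, n + n)) M,
        [/\ reduction_choices D I K V (mxrows BI) BV BW s M,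
            BVt = rows (BV - M *m BW)
          & J = recovery_set I (BV - M *m BW)]))
  /\
  (forall rI rV rW V (BI : 'M[F]_(rI, n + n)) (BV : 'M[F]_(rV, n + n))
     (BW : 'M[F]_(rW, n + n)) s (M : 'M[F]_(rV, rW)),
     reduction_choices D I K V BI BV BW s M ->
     let P := selected BW s in
     let BVt := BV - M *m BW in
     let Vt := <<rows BVt>>%VS in
     let J := recovery_set I BVt in
     let O := [set beta u | u in rows BI ++ rows BVt] in
     [/\ [/\ I \subset J, J \subset K,
             directv (shorten0 I D + Vt)
           & basis_of (shorten0 I D + Vt) (rows BI ++ rows BVt)],
         (#|J| <= #|K| - #|P|)%N,
         sufficient_observables C' I O /\
         J = [set i | lshift c i \in \bigcup_(v in O) supp v]
       & #|O| = \dim (puncture_set I D) /\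
         (forall T, sufficient_observables C' I T -> (#|O| <= #|T|)%N)]).
Proof.
exists 888%N => F p n c C C' alpha I K D D' beta _ _ _ _ _ _ _ _ _ D'C'.
move=> _ alpha_surj D'E _ /proper_sub sIK rep; split.
  move=> r BK s bK ps; case e: (run _) => [[BI BVt] J].
  split; last exact: reductionP bK ps e.
  (* A basis of sigma_K has at most [2 * #|K|] vectors, as they are supported on that many
     columns. *)
  apply: steps_reduction => //; rewrite -card_cols.
  rewrite -(eqP (basis_free bK)) (span_basis bK).
  exact/dim_zeros_outside/shorten0_zeros.
move=> rI rV rW V BI BV BW s M choices P BVt Vt J O.
have [dirVt basisVt] := reduced_basis choices.
have sJ := recovery_set_subset sIK choices.
have suppD u := reduced_supp choices (u := u).
have Osuff : sufficient_observables C' I O.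
  apply: (repair_sufficient D'C' alpha_surj D'E rep) => [u /suppD []//|].
  rewrite (span_basis basisVt) -(reduced_span choices).
  by apply: addvS => //; rewrite -shorten0_cap capvSr.
have sPK : P \subset K := subset_trans (selected_subset choices) (subsetDl K I).
have dimD : \dim (puncture_set I D) = (rI + rV)%N.
  (* The punctures to [I] of sigma_K, [D] and [C + D] form an increasing chain whose ends agree by
     the repair condition. *)
  have <- : puncture_set I (shorten0 K D) = puncture_set I D.
    by apply: subv_anti; rewrite limgS ?capvSl //= -rep limgS ?addvSr.
  (* The kernel of puncturing to [I] on sigma_K is the shortening to [K :\: I]; cancelling its
     dimension leaves [rI + rV]. *)
  apply: (@addnI (\dim (shorten0 (K :\: I) D))).
  rewrite -shorten0_cap dim_puncture_set (reduced_dim choices) shorten0_cap.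
  exact: addnC.
have cardO : #|O| = (rI + rV)%N.
  rewrite card_imset; last first.
    by apply: (can_inj (g := @gluel F n c)) => u; apply: gluelK.
  by rewrite (card_uniqP (free_uniq (basis_free basisVt))) size_cat !size_rows.
split.
- split=> //; first exact: subsetUl.
  by apply: subset_trans sJ (subsetDl _ _).
- apply: leq_trans (subset_leq_card sJ) _.
  by rewrite cardsD (setIidPr sPK).
- split=> //; apply/setP => i; rewrite mem_recovery_set [in RHS]in_set.
  apply/orP/idP => [[iI|/exists_inP [u uB iu]]|/bigcupP [_ /imsetP [u uB ->]]].
  (* That the supports of the rows cover all of [I] is deduced from sufficiency rather than from the
     rows themselves. *)
  + exact (sufficient_supp D'C' Osuff iI).
  + apply/bigcupP; exists (beta u); last by rewrite supp_glue.
    by apply: imset_f; rewrite mem_cat uB orbT.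
  rewrite supp_glue => iu; move: uB; rewrite mem_cat => /orP [uI|uB].
    left; have [_ bI _ _ _] := choices; have := basis_mem bI uI.
    by rewrite memv_cap mem_supported => /andP [_ /subsetP]; apply.
  by right; apply/exists_inP; exists u.
split=> [|T Tsuff]; rewrite cardO -dimD //.
exact: (sufficient_card D'C' D'E Tsuff).
Qed.
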